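(* Let $Q$ be a random quantile function on $[0,1]$ arising as the limit of a quantile pyramid, such that almost surely both $Q$ and $F=Q^{-1}$ are absolutely continuous with respect to Lebesgue measure on $[0,1]$; let $q=Q'$ be the quantile density (the limit of $q_m$), let $f=F'$ be the corresponding random density on $[0,1]$, and let $\Pi$ be the probability measure governing $q$ (and hence $Q$, $F$ and $f$). Let $f_0$ be a fixed density on $[0,1]$ with distribution function $F_0$ and quantile function $Q_0=F_0^{-1}$, where $F_0$ and $Q_0$ are absolutely continuous, and with quantile density $q_0(y)=1/f_0(Q_0(y))$. Assume: (A) for all $\varepsilon>0$, $\Pi\{q:\int_0^1 q(u)\log(q(u)/q_0(u))\,du<\varepsilon\}>0$; (B) for all $\delta>0$ there exists an $\varepsilon>0$ such that $$\int_0^1\log\frac{q_0(\tau_\varepsilon(u))}{q_0(u)}\,du<\delta$$ for any measurable function $\tau_\varepsilon:[0,1]\to[0,1]$ with $\max_u|\tau_\varepsilon(u)-u|<\varepsilon$; (C) the density $f_0$ is bounded by some $K<\infty$. Then each Kullback–Leibler neighborhood $\{f:\int_0^1 f_0\log(f_0/f)\,dx<\varepsilon\}$, $\varepsilon>0$, around the fixed $f_0$ has positive $\Pi$-probability.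
   Context: Quantile pyramid: for each $m\ge1$ and $j\in\{1,3,\dots,2^m-1\}$ let $V_{m,j}$ be a $[0,1]$-valued random variable, those at level $m$ being conditionally independent given those at earlier levels. Recursively, $Q_m$ agrees with $Q_{m-1}$ at the points $i/2^{m-1}$, $0\le i\le 2^{m-1}$ (the level-$0$ function being the identity), for odd $j$ $$Q_m(j/2^m)=Q_{m-1}((j-1)/2^m)(1-V_{m,j})+Q_{m-1}((j+1)/2^m)V_{m,j},$$ and $Q_m$ is linearly interpolated between the points $j/2^m$; $q_m=Q_m'$ outside these points. The limiting process is $Q=\lim_m Q_m$, and $q=\lim_m q_m$ with $Q(y)=\int_0^y q(u)\,du$. The quantile function of a distribution function $F$ is $F^{-1}(y)=\inf\{t:F(t)\ge y\}$, and conversely $F(x)=\sup\{y:Q(y)\le x\}$ is the distribution function with quantile function $Q$. *)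

(* Defs.v *)
From HB Require Import structures.
From mathcomp Require Import all_boot all_order all_algebra.
From mathcomp Require Import all_classical all_reals all_analysis.
Set Implicit Arguments.
Unset Strict Implicit.
Unset Printing Implicit Defensive.
Import Order.TTheory GRing.Theory Num.Theory.
Import numFieldNormedType.Exports.
Local Open Scope classical_set_scope.
Local Open Scope ring_scope.

(* Classical epsilon-delta absolute continuity on an interval D. *)
Definition abs_continuous_on (R : realType) (D : set R) (G : R -> R) : Prop :=
  forall e : R, 0 < e -> exists2 d : R, 0 < d &
    forall (n : nat) (a b : 'I_n -> R),
      (forall i, [/\ D (a i), D (b i) & a i <= b i]) ->
      (forall i j, i != j -> b i <= a j \/ b j <= a i) ->
      \sum_(i < n) (b i - a i) < d ->
      \sum_(i < n) `|G (b i) - G (a i)| < e.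

(* The function that is linear on each [i/2^m, (i+1)/2^m] and takes the value
   [a i] at i/2^m (meaningful on [0,1]; at y = 1 the weight of [a i.+1] is 0). *)
Definition dyadic_interp (R : realType) (m : nat) (a : nat -> R) (y : R) : R :=
  let i := Num.truncn (2 ^+ m * y) in
  let t := 2 ^+ m * y - i%:R in
  a i * (1 - t) + a i.+1 * t.

(* The functions Q_m; only the entries [v m j] with [is_node m j] matter. *)
Fixpoint pyramid (R : realType) (v : nat -> nat -> R) (m : nat) : R -> R :=
  if m is m'.+1 then
    dyadic_interp m (fun j : nat =>
      if odd j then pyramid v m' (j.-1%:R / 2 ^+ m) * (1 - v m j)
                  + pyramid v m' (j.+1%:R / 2 ^+ m) * v m j
      else pyramid v m' (j%:R / 2 ^+ m))
  else id.

Definition is_node (m j : nat) : bool := [&& (0 < m)%N, odd j & (j < 2 ^ m)%N].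

(* g is a version of the conditional probability P(A | S), for S a
   sub-sigma-algebra. *)
Definition is_cond_prob (R : realType) (d : measure_display)
    (T : measurableType d) (P : probability T R) (S : set (set T)) (A : set T)
    (g : T -> R) : Prop :=
  [/\ forall B : set R, measurable B -> S (g @^-1` B),
      P.-integrable setT (EFin \o g) &
      forall E : set T, S E -> (\int[P]_(w in E) (g w)%:E = P (A `&` E))%E].

Definition past_sigma_algebra (R : realType) (d : measure_display)
    (T : measurableType d) (P : probability T R)
    (V : nat -> nat -> {RV P >-> R}) (m : nat) : set (set T) :=
  <<s [set E | exists k j (B : set R),
         [/\ (k < m)%N, is_node k j, measurable B & E = V k j @^-1` B] ]>>.

(* Taking some B j to be setT covers the subfamilies. *)
Definition levels_cond_indep (R : realType) (d : measure_display)
    (T : measurableType d) (P : probability T R)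
    (V : nat -> nat -> {RV P >-> R}) : Prop :=
  forall (m : nat) (B : nat -> set R), (0 < m)%N ->
    (forall j, measurable (B j)) ->
    exists2 g : nat -> T -> R,
      (forall j, is_node m j ->
         is_cond_prob P (past_sigma_algebra V m) (V m j @^-1` B j) (g j)) &
      is_cond_prob P (past_sigma_algebra V m)
        (\bigcap_(j in [set j | is_node m j]) V m j @^-1` B j)
        (fun w => \prod_(j < 2 ^ m | is_node m j) g j w).

(* Q = lim Q_m and q = lim q_m = Q', with Q the integral of q.  The densities
   q_m = Q_m' exist off the dyadic points, and q is determined up to a null
   set. *)
Definition pyramid_limit (R : realType) (v : nat -> nat -> R) (Q q : R -> R)
    : Prop :=
  [/\ forall y, y \in `[0, 1] -> pyramid v m y @[m --> \oo] --> Q y,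
      {ae lebesgue_measure, forall u, u \in `[(0 : R), 1] ->
         derive1 (pyramid v m) u @[m --> \oo] --> q u},
      {ae lebesgue_measure, forall u, u \in `[(0 : R), 1] ->
         is_derive u 1 Q (q u)},
      lebesgue_measure.-integrable `[0, 1] (EFin \o q) &
      forall y, y \in `[0, 1] ->
        ((Q y)%:E = \int[lebesgue_measure]_(u in `[0%R, y]) (q u)%:E)%E].

(* F(x) = sup {y : Q(y) <= x}, on the whole line: it is 0 for x < 0 (the sup
   of the empty set being 0) and 1 for x >= 1. *)
Definition df_of_quantile (R : realType) (Q : R -> R) (x : R) : R :=
  sup [set y | y \in `[0, 1] /\ Q y <= x].

(* f is a version of the derivative F' on [0,1]. *)
Definition is_derivative_version (R : realType) (F f : R -> R) : Prop :=
  measurable_fun `[(0 : R), 1] f /\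
  {ae lebesgue_measure, forall x, x \in `[(0 : R), 1] -> is_derive x 1 F (f x)}.

Definition is_density01 (R : realType) (f : R -> R) : Prop :=
  [/\ measurable_fun `[(0 : R), 1] f,
      forall x, x \in `[0, 1] -> 0 <= f x &
      (\int[lebesgue_measure]_(x in `[0%R, 1%R]) (f x)%:E = 1)%E].

Definition df_of_density (R : realType) (f : R -> R) (x : R) : R :=
  \int[lebesgue_measure]_(t in `[(0 : R), 1] `&` `]-oo, x]) f t.

(* The infimum is over the support interval [0,1], so that the value at 0 is 0
   and not -oo. *)
Definition quantile01 (R : realType) (F : R -> R) (y : R) : R :=
  inf [set t | t \in `[0, 1] /\ y <= F t].

(* q_0(y) = 1 / f_0(Q_0(y)), with value +oo where f_0(Q_0(y)) = 0. *)
Definition quantile_density (R : realType) (f : R -> R) (y : R) : \bar R :=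
  ((f (quantile01 (df_of_density f) y))%:E^-1)%E.

(* int_0^1 g log(g/h); the convention 0 log(0/h) = 0 is that of [*%E]. *)
Definition KL01 (R : realType) (g : R -> R) (h : R -> \bar R) : \bar R :=
  (\int[lebesgue_measure]_(x in `[0%R, 1%R])
     ((g x)%:E * lne ((g x)%:E / h x)))%E.

(* For measurable A this is 0 < P A; a general A, on which the function P is
   unspecified, must contain a measurable set of positive probability. *)
Definition has_pos_prob (R : realType) (d : measure_display)
    (T : measurableType d) (P : probability T R) (A : set T) : Prop :=
  exists B : set T, [/\ measurable B, B `<=` A & (0 < P B)%E].

(* Main.v *)
(* Write F, F0, Q, Q0 for the distribution and quantile functions.  If U is
   uniform on [0,1], then Q0(U) has density f0 and F(U) has density q (it is
   the inverse of Q), so that integrals against f0 and q are integrals of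
   compositions with Q0 and F.  As f = 1 / q(F) almost everywhere,
     f0 log (f0 / f) = f0 log (q(F) / q0(F)) + f0 log (q0(F) f0).
   The positive part of the first term integrates to at most
   K int q log+ (q / q0), which is small when KL(q, q0) is.  The second term
   integrates to int log (q0(tau) / q0) with tau = F o Q0, which is (B).
   That tau is close to the identity follows from
   |q - q0| <= (q log (q / q0) - q + q0) / (2 s) + s (q + q0), which makes the L1
   distance of q and q0, hence the distance of Q and Q0, small, and from F0
   being K-Lipschitz: tau(u) - u = F0(Q0(v)) - F0(Q(v)) with v = tau(u). *)
Require Import Defs.
From HB Require Import structures.
From mathcomp Require Import all_boot all_order all_algebra.
From mathcomp Require Import all_classical all_reals all_analysis.
From mathcomp Require Import measurable_realfun ring lra.
Import Order.TTheory GRing.Theory Num.Theory.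
Import numFieldNormedType.Exports.
Local Open Scope classical_set_scope.
Local Open Scope ring_scope.

Set Implicit Arguments.
Unset Strict Implicit.
Unset Printing Implicit Defensive.

(** * Integration *)

Section density_measure.
Context d (T : measurableType d) (R : realType).
Variables (mu : {sigma_finite_measure set T -> \bar R}) (r : T -> R).
Hypotheses (r0 : forall x, 0 <= r x) (ri : mu.-integrable setT (EFin \o r)).
Local Open Scope ereal_scope.

Definition density_measure (A : set T) : \bar R := \int[mu]_(x in A) (r x)%:E.

Let density0 : density_measure set0 = 0.
Proof. exact: integral_set0. Qed.

Let density_ge0 A : 0 <= density_measure A.
Proof. by apply: integral_ge0 => x _; rewrite lee_fin. Qed.

Let density_sigma_additive : semi_sigma_additive density_measure.
Proof.
move=> /= A mA tA mUA.
rewrite /density_measure integral_bigcup//=; last exact: integrableS ri.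
apply: is_cvg_ereal_nneg_natsum_cond => n _ _.
by apply: integral_ge0 => x _; rewrite lee_fin.
Qed.

HB.instance Definition _ := isMeasure.Build _ _ _
  density_measure density0 density_ge0 density_sigma_additive.

Let density_fin : fin_num_fun density_measure.
Proof.
move=> A mA; rewrite ge0_fin_numE ?density_ge0//.
by apply: integrable_lty => //; exact: integrableS ri.
Qed.

HB.instance Definition _ :=
  @Measure_isFinite.Build _ _ _ density_measure density_fin.

Lemma density_measure_dominates : density_measure `<< mu.
Proof.
apply/null_content_dominatesP => A mA muA.
apply: null_set_integral => //.
by apply: (measurable_funS measurableT) => //; exact: measurable_int ri.
Qed.

(** The Radon-Nikodym derivative of [density_measure] has the same integral as [r] over every
    measurable set, hence equals [r] almost everywhere; the change of variables for the derivative
    then gives the formula with [r]. *)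
Lemma ge0_integral_density_measure D (g : T -> \bar R) :
  measurable D -> measurable_fun D g -> (forall x, D x -> 0 <= g x) ->
  \int[density_measure]_(x in D) g x = \int[mu]_(x in D) (g x * (r x)%:E).
Proof.
move=> mD mg g0.
pose gD : T -> \bar R := g \_ D.
have mgD : measurable_fun setT gD by exact/(measurable_restrictT _ _).1.
rewrite [LHS]integral_mkcond -/gD.
have numu := density_measure_dominates.
rewrite -(Radon_Nikodym_SigmaFinite.change_of_variables numu)//; last first.
  by apply: erestrict_ge0.
have mf : measurable_fun setT (Radon_Nikodym_SigmaFinite.f density_measure mu).
  exact/measurable_int/Radon_Nikodym_SigmaFinite.f_integrable.
have mr : measurable_fun setT (EFin \o r) by exact: measurable_int ri.
rewrite [RHS]integral_mkcond.
rewrite (_ : _ \_ D = gD \* (EFin \o r)); last first.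
  by apply/funext => x; rewrite /gD /= !patchE; case: ifPn => // _; rewrite mul0e.
apply: ae_eq_integral => //.
- exact: emeasurable_funM.
- exact: emeasurable_funM.
apply: ae_eqe_mul2l.
apply: integral_ae_eq => //; first exact: Radon_Nikodym_SigmaFinite.f_integrable.
by move=> E _ mE; rewrite -Radon_Nikodym_SigmaFinite.f_integral.
Qed.

End density_measure.

(** * Measures determined by their distribution function, and images of the uniform law *)

Section transport.
Context (R : realType).
Notation mu := (@lebesgue_measure R).
Local Open Scope ereal_scope.

(** A half-open interval is a difference of two closed left rays. Rays are also stable under
    intersection, so they can serve as a pi-system for the uniqueness of measures. *)
Lemma measurable_ray : (@measurable _ R) =
  <<s [set B | exists y : R, B = `]-oo, y]%classic] >>.
Proof.
apply/seteqP; split => A.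
  apply: smallest_sub; first exact: smallest_sigma_algebra.
  move=> _ [[a b] _ <-] /=.
  rewrite (_ : `]a, b]%classic = `]-oo, b]%classic `\` `]-oo, a]%classic).
    pose G : set (set R) := [set B | exists y : R, B = `]-oo, y]%classic].
    have mG y : G.-sigma.-measurable `]-oo, y]%classic.
      by apply: sub_sigma_algebra; exists y.
    exact: (@measurableD _ (g_sigma_algebraType G)).
  apply/seteqP; split => x /=; rewrite !in_itv/=.
    by move=> /andP[ax ->]; split => //; apply/negP; rewrite -ltNge.
  by move=> [-> /negP]; rewrite -ltNge => ->.
apply: smallest_sub; first exact: sigma_algebra_measurable.
by move=> _ [y ->]; exact: measurable_itv.
Qed.

Lemma measure_eq_of_cdf (m1 m2 : {measure set (measurableTypeR R) -> \bar R}) :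
  m1 setT < +oo -> (forall y : R, m1 `]-oo, y]%classic = m2 `]-oo, y]%classic) ->
  forall A, measurable A -> m1 A = m2 A.
Proof.
move=> fin eq12 A mA.
apply: (@measure_unique _ _ (measurableTypeR R)
  [set B | exists y : R, B = `]-oo, y]%classic]
  (fun n : nat => `]-oo, n%:R]%classic)) => //.
- exact: measurable_ray.
- move=> _ _ [x ->] [y ->]; exists (Num.min x y).
  apply/seteqP; split => z /=; rewrite !in_itv/= le_min.
    by case => -> ->.
  by move=> /andP[].
- by move=> n; exists n%:R.
- apply/seteqP; split => // x _; exists (Num.truncn `|x|).+1 => //=.
  rewrite in_itv/= (le_trans (ler_norm x))//.
  by apply/ltW/truncnS_gt; rewrite ?num_real.
- by move=> _ [y ->].
- move=> n; apply: le_lt_trans fin; apply: le_measure; rewrite ?inE//.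
Qed.

Local Notation D := (`[0%R : R, 1%R]%classic : set R).

(* [phi] maps a random variable that is uniform on [0,1] to one of density [r]. *)
Definition transports_uniform (phi r : R -> R) : Prop :=
  [/\ measurable_fun D phi, forall x : R, x \in `[0%R, 1%R] -> phi x \in `[0%R, 1%R],
      measurable_fun D r, forall x : R, x \in `[0%R, 1%R] -> (0 <= r x)%R &
      forall y : R, y \in `[0%R, 1%R] -> mu (D `&` [set x | (phi x <= y)%R]) =
        \int[mu]_(x in D `&` `]-oo, y]) (r x)%:E].

(** On [D], the image of Lebesgue measure under [phi] and the measure of density [r] have the same
    distribution function, so they coincide, and both integrals are integrals of [g] against this
    measure. *)
Lemma ge0_integral_transport (phi r : R -> R) (g : R -> \bar R) :
  transports_uniform phi r ->
  measurable_fun D g -> (forall x : R, x \in `[0%R, 1%R] -> 0 <= g x) ->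
  \int[mu]_(x in D) g (phi x) = \int[mu]_(x in D) (g x * (r x)%:E).
Proof.
move=> [mphi phiD mr r0 cdf01].
(* The identity extends from [0,1] to the line: both sides vanish for [y < 0] and are constant for
   [y >= 1], as [phi] has values in [0,1]. *)
have cdf (y : R) : mu (D `&` [set x | (phi x <= y)%R]) =
    \int[mu]_(x in D `&` `]-oo, y]) (r x)%:E.
  have [y0|y0] := ltP y 0%R.
    rewrite (_ : D `&` [set x | (phi x <= y)%R] = set0); last first.
      apply/seteqP; split => // x /= [/phiD]; rewrite in_itv/= => /andP[? _]; lra.
    rewrite (_ : D `&` `]-oo, y]%classic = set0) ?measure0 ?integral_set0//.
    apply/seteqP; split => // x /= []; rewrite !in_itv/= => /andP[? _]; lra.
  have [y1|y1] := leP y 1%R; first by apply: cdf01; rewrite in_itv/= y0.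
  have := cdf01 1%R; rewrite in_itv/= ler01 lexx => /(_ isT).
  rewrite (_ : D `&` [set x | (phi x <= 1)%R] =
      D `&` [set x | (phi x <= y)%R]); last first.
    apply/seteqP; split => x /= [xD]; have := phiD _ xD;
      rewrite in_itv/= => /andP[? ?] ?; split => //; lra.
  move=> ->; congr (\int[mu]_(x in _) _).
  apply/seteqP; split => x /= []; rewrite !in_itv/= => /andP[x0 x1] _;
    rewrite x0 x1; split => //; lra.
move=> mg g0.
have mD : measurable D by exact: measurable_itv.
have muD : mu D < +oo by rewrite lebesgue_measure_itv/= lte01 -EFinB ltry.
(* [phi1] is [phi] on [D] and 2 elsewhere. The value 2 lies outside [D], so that the preimage of [D]
   is exactly [D]. *)
pose phi1 x : R := (((fun x => phi x - 2) \_ D) x + 2)%R.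
have mphi1 : measurable_fun setT phi1.
  apply: measurable_funD => //; apply/(measurable_restrictT _ _).1 => //.
  exact: measurable_funB.
have phi1E x : D x -> phi1 x = phi x.
  by move=> Dx; rewrite /phi1 patchE mem_set// subrK.
have phi1D : phi1 @^-1` D = D.
  apply/seteqP; split => x /=; last by move=> Dx; rewrite phi1E//; exact: phiD.
  rewrite /phi1 patchE; case: ifPn => [/set_mem//|_].
  by rewrite /= add0r in_itv/= => /andP[_]; lra.
pose rD : R -> R := r \_ D.
have rD0 x : (0 <= rD x)%R by rewrite /rD patchE; case: ifPn => // /set_mem; exact: r0.
have mrD : measurable_fun setT rD by exact/(measurable_restrictT _ _).1.
have rDE A : measurable A ->
    \int[mu]_(x in A) (rD x)%:E = \int[mu]_(x in D `&` A) (r x)%:E.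
  move=> mA; rewrite setIC [RHS]integral_mkcondr; apply: eq_integral => x _.
  by rewrite /rD !patchE; case: ifPn.
have irD : mu.-integrable setT (EFin \o rD).
  apply/integrableP; split; first exact/measurable_EFinP.
  under eq_integral do rewrite /= ger0_norm//.
  rewrite rDE// setIT (_ : D = D `&` `]-oo, 1%R]%classic); last first.
    apply/esym/setIidl => x; rewrite /= !in_itv/= => /andP[].
    by [].
  rewrite -cdf; apply: le_lt_trans muD; apply: le_measure; rewrite ?inE//.
  rewrite -[X in D `&` X](_ : phi @^-1` `]-oo, 1%R]%classic = _).
    exact: mphi.
  by apply/seteqP; split => x /=; rewrite in_itv.
have [m0 m0E] : exists m : {measure set (measurableTypeR R) -> \bar R},
    m = pushforward mu (phi1 : measurableTypeR R -> measurableTypeR R)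
      :> (set (measurableTypeR R) -> \bar R).
  by unshelve eexists [the measure _ _ of
    pushforward mu (phi1 : measurableTypeR R -> measurableTypeR R)].
(* The image measure [m0] has infinite mass at 2; its restriction to [D] is finite. *)
pose m1 := mrestr m0 mD.
pose m2 := density_measure mu rD.
have [m2' m2E] : exists m : {measure set (measurableTypeR R) -> \bar R},
    m = m2 :> (set (measurableTypeR R) -> \bar R).
  by unshelve eexists [the measure _ _ of m2].
have m12 A : measurable A -> m1 A = m2' A.
  apply: measure_eq_of_cdf.
    rewrite /= /mrestr setTI m0E /pushforward.
    by rewrite phi1D.
  move=> y; rewrite m2E [RHS]rDE// -cdf /= /mrestr m0E /pushforward.
  congr (mu _); rewrite preimage_setI phi1D setIC.
  apply/seteqP; split => x /= [Dx]; rewrite in_itv/= phi1E//.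
transitivity (\int[m0]_(y in D) g y).
  rewrite m0E ge0_integral_pushforward//; last by move=> x /set_mem; exact: g0.
  by rewrite phi1D; apply: eq_integral => x /set_mem Dx /=; rewrite phi1E.
transitivity (\int[m2']_(y in D) g y).
  apply: eq_measure_integral => A mA AD; rewrite -m12//.
  by rewrite /m1 /mrestr setIidl.
rewrite m2E ge0_integral_density_measure//.
by apply: eq_integral => x Dx; rewrite /rD patchE Dx.
Qed.

End transport.

(** * Integrals that may be infinite *)

Section extended_integrals.
Context d (T : measurableType d) (R : realType).
Variables (mu : {measure set T -> \bar R}) (D : set T).
Hypothesis mD : measurable D.
Local Open Scope ereal_scope.

(* Pitfall: a function whose positive and negative parts both have integral oo
   has integral oo - oo = -oo. *)
Lemma ae_le_integral (f g : T -> \bar R) :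
  measurable_fun D f -> measurable_fun D g ->
  {ae mu, forall x, D x -> f x <= g x} ->
  \int[mu]_(x in D) f x <= \int[mu]_(x in D) g x.
Proof.
move=> mf mg fg; rewrite integralE [leRHS]integralE; apply: leeB.
- apply: ae_ge0_le_integral => //; try exact: measurable_funepos.
  apply: filterS fg => x /[apply] fgx; rewrite !funeposE.
  by rewrite ge_max !le_max fgx lexx orbT.
- apply: ae_ge0_le_integral => //; try exact: measurable_funeneg.
  apply: filterS fg => x /[apply] fgx; rewrite !funenegE.
  by rewrite ge_max !le_max leeN2 fgx lexx orbT.
Qed.

(* If the negative part of [h] has infinite integral, so has that of [a + h], and
   both sides are -oo. *)
Lemma integral_addl_le (a h : T -> R) :
  measurable_fun D h -> (forall x, D x -> (0 <= a x)%R) ->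
  mu.-integrable D (EFin \o a) ->
  \int[mu]_(x in D) (a x + h x)%:E <=
  \int[mu]_(x in D) (a x)%:E + \int[mu]_(x in D) (h x)%:E.
Proof.
move=> mh a0 ia; have ma : measurable_fun D a.
  by apply/measurable_EFinP; exact: measurable_int ia.
have mE : measurable_fun D (EFin \o h) by exact/measurable_EFinP.
have iafin : \int[mu]_(x in D) (a x)%:E \is a fin_num by exact: integrable_fin_num.
have [ih|nih] := pselect (mu.-integrable D (EFin \o h)).
  by under eq_integral do rewrite EFinD; rewrite integralD.
have mah : measurable_fun D (fun x => (a x + h x)%:E).
  by apply/measurable_EFinP; exact: measurable_funD.
have [hn|] := ltP (\int[mu]_(x in D) (EFin \o h)^\- x) +oo; last first.
  rewrite leye_eq => /eqP hn.
  (* Pointwise [h^- <= (a + h)^- + a]. As [a] has a finite integral, [(a + h)^-] inherits the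
     infinite integral of [h^-]. *)
  have : \int[mu]_(x in D) (EFin \o h)^\- x <=
      \int[mu]_(x in D) ((fun x => (a x + h x)%:E)^\- x + (a x)%:E).
    apply: ge0_le_integral => //.
    - exact: measurable_funeneg.
    - by apply: emeasurable_funD; [exact: measurable_funeneg|exact/measurable_EFinP].
    - move=> x Dx; rewrite !funenegE /= -!EFin_max -EFinD lee_fin.
      rewrite addr_maxl ge_max le_max; have := a0 _ Dx.
      rewrite le_max add0r => ->; rewrite orbT andbT.
      by apply/orP; left; rewrite opprD addrAC addNr add0r.
  rewrite ge0_integralD//; last 2 first.
  - exact: measurable_funeneg.
  - exact/measurable_EFinP.
  rewrite hn leye_eq => /eqP NA.
  rewrite [leLHS]integralE (_ : \int[mu]_(x in D) _^\- x = +oo) ?addeNy ?leNye//.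
  apply/eqP; rewrite -leye_eq leNgt; apply/negP => N.
  by have := lte_add_pinfty N (integrable_lty mD ia); rewrite NA ltxx.
(* In the remaining case [h] is not integrable although its negative part is, so the right-hand side
   is +oo. *)
have hp : \int[mu]_(x in D) (EFin \o h)^\+ x = +oo.
  apply/eqP; rewrite -leye_eq leNgt; apply/negP => hp; apply: nih.
  apply/integrableP; split => //.
  rewrite (eq_integral (fun x => (EFin \o h)^\+ x + (EFin \o h)^\- x)); last first.
    by move=> x _; exact: (congr1 (@^~ x) (fune_abse (EFin \o h))).
  rewrite ge0_integralD//; last 2 first.
  - exact: measurable_funepos.
  - exact: measurable_funeneg.
  exact: lte_add_pinfty.
rewrite [X in _ <= _ + X]integralE hp.
rewrite addye; last by rewrite eqe_oppLR /= lt_eqF.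
by rewrite addey ?leey// gt_eqF// (lt_le_trans _ (integral_ge0 _ _)).
Qed.

End extended_integrals.

(** * Pointwise inequalities for the Kullback-Leibler integrand *)

Section kullback_leibler_inequalities.
Context {R : realType}.
Implicit Types (p q s : R).

(** With [a], [b] the square roots of [p], [q], the inequality [ln x <= x - 1] at [x = b / a] gives
    [p ln (p / q) = - 2 a^2 ln (b / a) >= 2 a^2 - 2 a b], which is the left-hand side. *)
Lemma mulr_ln_div_ge_hellinger p q : 0 <= p -> 0 < q ->
  (Num.sqrt p - Num.sqrt q) ^+ 2 + p - q <= p * ln (p / q).
Proof.
move=> p0 q0; set a := Num.sqrt p; set b := Num.sqrt q.
have a2 : p = a ^+ 2 by rewrite sqr_sqrtr.
have b2 : q = b ^+ 2 by rewrite sqr_sqrtr// ltW.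
have b0 : 0 < b by rewrite sqrtr_gt0.
have [a0|a0] := eqVneq a 0.
  by rewrite a2 b2 a0 expr0n/= mul0r; nra.
have {}a0 : 0 < a by rewrite lt_def a0 sqrtr_ge0.
have h : ln (b / a) <= b / a - 1.
  have := @le_ln1Dx R (b / a - 1); rewrite [1 + _]addrC subrK; apply.
  by rewrite ltrBrDr addNr divr_gt0.
rewrite a2 b2 -expr_div_n lnXn ?divr_gt0// -[a / b]invf_div lnV ?posrE ?divr_gt0//.
have a2_gt0 : 0 < a ^+ 2 by rewrite exprn_gt0.
have : a ^+ 2 * ln (b / a) <= a * b - a ^+ 2.
  rewrite [leRHS](_ : _ = a ^+ 2 * (b / a - 1)) ?ler_pM2l//.
  by field; rewrite gt_eqF.
rewrite mulNrn mulrN mulrnAr mulr2n; nra.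
Qed.

Lemma mulr_ln_div_ge p q : 0 <= p -> 0 < q -> p - q <= p * ln (p / q).
Proof.
move=> p0 q0; apply: le_trans (mulr_ln_div_ge_hellinger p0 q0).
by rewrite -addrA lerDr sqr_ge0.
Qed.

(** With the same [a], [b]: [2 s |a - b| (a + b) <= (a - b)^2 + s^2 (a + b)^2] and
    [(a + b)^2 <= 2 (p + q)]. The parameter [s] does the work of the Cauchy-Schwarz inequality once
    this pointwise bound is integrated. *)
Lemma normr_sub_le_mulr_ln_div p q s : 0 <= p -> 0 < q -> 0 < s ->
  2 * s * (`|p - q| - s * (p + q)) + (p - q) <= p * ln (p / q).
Proof.
move=> p0 q0 s0; apply: le_trans (mulr_ln_div_ge_hellinger p0 q0).
rewrite -[leRHS]addrA lerD2r; set a := Num.sqrt p; set b := Num.sqrt q.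
have a2 : p = a ^+ 2 by rewrite sqr_sqrtr.
have b2 : q = b ^+ 2 by rewrite sqr_sqrtr// ltW.
rewrite a2 b2 subr_sqr normrM (ger0_norm (_ : 0 <= a + b)) ?addr_ge0 ?sqrtr_ge0//.
rewrite -[leRHS]real_normK ?num_real//; set c := `|a - b|.
have : 0 <= (c - s * (a + b)) ^+ 2 by exact: sqr_ge0.
have : 0 <= (s * (a - b)) ^+ 2 by exact: sqr_ge0.
nra.
Qed.

(** Where the logarithm is negative, the right-hand side is still at least
    [|p - q| + p - q >= 0]. *)
Lemma mulr_max_ln_div_le p q : 0 <= p -> 0 < q ->
  p * Num.max (ln (p / q)) 0 <= `|p - q| + p * ln (p / q).
Proof.
move=> p0 q0; have := mulr_ln_div_ge p0 q0.
have := ler_norm (p - q); have := ler_norm (q - p); rewrite distrC.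
by rewrite maxEle; case: ifPn => _; rewrite ?mulr0; lra.
Qed.

End kullback_leibler_inequalities.

(** * Quantile functions and distribution functions *)

Section monotone_inverses.
Context {R : realType}.
Variable G : R -> R.
Hypotheses (G0 : G 0 = 0) (G1 : G 1 = 1).
Hypothesis ndG : forall x y : R, 0 <= x -> x <= y -> y <= 1 -> G x <= G y.
(** Uniform continuity on [0,1], without absolute values because [G] is nondecreasing there. [G]
    will be both the random [Q], inverted by a sup, and [df_of_density f0], inverted by an inf. *)
Hypothesis cG : forall e : R, 0 < e -> exists2 t : R, 0 < t &
  forall x y : R, 0 <= x -> x <= y -> y <= 1 -> y - x < t -> G y - G x < e.

Let S x := [set y | y \in `[0, 1] /\ G y <= x].

Let hsS x : 0 <= x -> has_sup (S x).
Proof.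
move=> x0; split; first by exists 0; split; rewrite ?G0// in_itv/= lexx ler01.
by exists 1 => y [] /itvP ->.
Qed.

Let hiS u : u <= 1 -> has_inf [set t | t \in `[0, 1] /\ u <= G t].
Proof.
move=> u1; split; first by exists 1; split; rewrite ?G1// in_itv/= lexx ler01.
by exists 0 => y [] /itvP ->.
Qed.

Lemma df_of_quantile_in x : df_of_quantile G x \in `[0, 1].
Proof.
rewrite /df_of_quantile -/(S x); have [S0|/set0P S0] := eqVneq (S x) set0.
  by rewrite S0 sup0 in_itv/= lexx ler01.
rewrite in_itv/=; apply/andP; split.
  have [y Sy] := S0; have := Sy => -[] /itvP yI _.
  apply: (@le_trans _ _ y); rewrite ?yI//; apply: ub_le_sup => //.
  by exists 1 => z [] /itvP ->.
by apply: ge_sup => // z [] /itvP ->.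
Qed.

Lemma nondecreasing_df_of_quantile : nondecreasing_fun (df_of_quantile G).
Proof.
move=> x y xy; have [S0|/set0P S0] := eqVneq (S x) set0.
  rewrite {1}/df_of_quantile -/(S x) S0 sup0.
  by have := df_of_quantile_in y; rewrite in_itv/= => /andP[].
apply: le_sup => //.
- move=> z [zI Gz]; exists z; split => //.
  by split => //; exact: le_trans Gz xy.
- split; first by have [z [zI Gz]] := S0; exists z; split => //; exact: le_trans Gz xy.
  by exists 1 => z [] /itvP ->.
Qed.

(** Continuity at the supremum [m]: elements of [S x] close to [m] give [G m <= x], and points just
    above [m], being outside [S x], give [x <= G m]. If [m = 1] there are no such points, but
    [G 1 = 1]. *)
Lemma df_of_quantileK x : 0 <= x -> x <= 1 -> G (df_of_quantile G x) = x.
Proof.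
move=> x0 x1; have := df_of_quantile_in x; set m := df_of_quantile G x => /itvP mI.
have hs := hsS x0.
apply/eqP; rewrite eq_le; apply/andP; split.
- apply/ler_addgt0Pr => e e0; have [t t0 tG] := cG e0.
  have [y [yI Gy] my] := sup_adherent t0 hs.
  have ym : y <= m by apply: ub_le_sup => //; exact: hs.2.
  have yt : m - y < t by move: my; rewrite -/(df_of_quantile G x) -/m; lra.
  have := tG _ _ _ ym _ yt; rewrite (itvP yI) mI => /(_ isT isT).
  lra.
- apply/ler_addgt0Pr => e e0; have [t t0 tG] := cG e0.
  have [m1|m1] := eqVneq m 1; first by rewrite m1 G1; lra.
  have {}m1 : m < 1 by rewrite lt_def eq_sym m1 mI.
  pose y := Num.min 1 (m + t / 2).
  have my : m < y by rewrite /y lt_min m1; lra.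
  have y1 : y <= 1 by rewrite /y ge_min lexx.
  have yt : y - m < t.
    have : y <= m + t / 2 by rewrite /y ge_min lexx orbT.
    lra.
  have Gy : x < G y.
    rewrite ltNge; apply/negP => Gy; suff : y <= m by lra.
    apply: ub_le_sup; first exact: hs.2.
    by split => //; rewrite in_itv/= y1 andbT; apply/ltW/(le_lt_trans _ my); rewrite mI.
  have := tG _ _ _ (ltW my) y1 yt; rewrite mI => /(_ isT).
  lra.
Qed.

Lemma quantile01_in u : u <= 1 -> quantile01 G u \in `[0, 1].
Proof.
move=> u1; rewrite in_itv/=; apply/andP; split.
  by apply: lb_le_inf; [exact: (hiS u1).1|move=> z [] /itvP ->].
apply: ge_inf; first exact: (hiS u1).2.
by split; rewrite ?G1// in_itv/= lexx ler01.
Qed.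

Lemma quantile01K u : 0 <= u -> u <= 1 -> G (quantile01 G u) = u.
Proof.
move=> u0 u1; have := quantile01_in u1; set m := quantile01 G u => /itvP mI.
have hs := hiS u1.
apply/eqP; rewrite eq_le; apply/andP; split.
- apply/ler_addgt0Pr => e e0; have [t t0 tG] := cG e0.
  have [m0|m0] := eqVneq m 0; first by rewrite m0 G0; lra.
  have {}m0 : 0 < m by rewrite lt_def m0 mI.
  pose y := Num.max 0 (m - t / 2).
  have my : y < m by rewrite /y gt_max m0; lra.
  have y0 : 0 <= y by rewrite /y le_max lexx.
  have yt : m - y < t.
    have : m - t / 2 <= y by rewrite /y le_max lexx orbT.
    lra.
  have Gy : G y < u.
    rewrite ltNge; apply/negP => Gy; suff : m <= y by lra.
    apply: ge_inf; first exact: hs.2.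
    split => //; rewrite in_itv/= y0/=; apply/ltW/(lt_le_trans my); by rewrite mI.
  have := tG _ _ y0 (ltW my) _ yt; rewrite mI => /(_ isT).
  lra.
- apply/ler_addgt0Pr => e e0; have [t t0 tG] := cG e0.
  have [y [yI Gy] my] := inf_adherent t0 hs.
  have ym : m <= y by apply: ge_inf => //; exact: hs.2.
  have yt : y - m < t by move: my; rewrite -/(quantile01 G u) -/m; lra.
  have := tG _ _ _ ym _ yt; rewrite (itvP yI) mI => /(_ isT isT).
  lra.
Qed.

(** The Galois connection of the generalized inverse; it turns sublevel sets of the quantile
    function into intervals. *)
Lemma quantile01_le u y : 0 <= u -> u <= 1 -> y \in `[0, 1] ->
  (quantile01 G u <= y) = (u <= G y).
Proof.
move=> u0 u1 yI; apply/idP/idP => [uy|uy].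
  rewrite -[leLHS](quantile01K u0 u1); apply: ndG; rewrite ?(itvP yI)//.
  by rewrite (itvP (quantile01_in u1)).
by apply: ge_inf; [exact: (hiS u1).2|split].
Qed.

Lemma nondecreasing_quantile01 u v : 0 <= u -> u <= v -> v <= 1 ->
  quantile01 G u <= quantile01 G v.
Proof.
move=> u0 uv v1; rewrite quantile01_le ?(le_trans uv)//.
  by rewrite quantile01K// (le_trans u0).
exact: quantile01_in.
Qed.

Lemma measurable_quantile01 : measurable_fun `[(0 : R), 1]%classic (quantile01 G).
Proof.
(* Monotonicity is known on [0,1] only; composing with the projection [c] onto [0,1] makes the
   function monotone on the line. *)
pose c u : R := Num.max 0 (Num.min 1 u).
have c01 u : 0 <= c u <= 1 by rewrite /c le_max lexx/= ge_max ge_min lexx ler01.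
apply: (eq_measurable_fun (quantile01 G \o c)).
  move=> u /set_mem /=; rewrite in_itv/= => /andP[u0 u1].
  by rewrite /c (min_idPr u1) (max_idPr u0).
apply: nondecreasing_measurable => // u v uv /=.
have /andP[? ?] := c01 u; have /andP[? ?] := c01 v.
apply: nondecreasing_quantile01 => //.
rewrite /c ge_max le_max lexx/= le_max; apply/orP; right.
by rewrite le_min !ge_min lexx uv orbT.
Qed.

Lemma lebesgue_measure_quantile01_le y : y \in `[0, 1] ->
  lebesgue_measure (`[(0 : R), 1] `&` [set u | quantile01 G u <= y]) = (G y)%:E.
Proof.
move=> yI; have Gy0 : 0 <= G y by rewrite -G0; apply: ndG; rewrite ?(itvP yI).
have Gy1 : G y <= 1 by rewrite -G1; apply: ndG; rewrite ?(itvP yI).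
rewrite (_ : _ `&` _ = `[0, G y]%classic); last first.
  apply/seteqP; split => u /=; rewrite !in_itv/=.
    by move=> [/andP[u0 u1]]; rewrite quantile01_le// u0.
  move=> /andP[u0 uy]; have u1 : u <= 1 by exact: le_trans Gy1.
  by rewrite quantile01_le// u0 u1.
by rewrite lebesgue_measure_itv/= lte_fin sube0; case: ltgtP Gy0 => // <-.
Qed.

(** The set lies between [[0, G y[] and [[0, G y]], which have equal measure. Whether it contains
    [G y] depends on whether [G] is constant to the right of [y]. *)
Lemma lebesgue_measure_df_of_quantile_le y : y \in `[0, 1] ->
  lebesgue_measure (`[(0 : R), 1] `&` [set x | df_of_quantile G x <= y]) = (G y)%:E.
Proof.
move=> yI; have Gy0 : 0 <= G y by rewrite -G0; apply: ndG; rewrite ?(itvP yI).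
have Gy1 : G y <= 1 by rewrite -G1; apply: ndG; rewrite ?(itvP yI).
have mF : measurable (`[(0 : R), 1] `&` [set x | df_of_quantile G x <= y]).
  apply: measurableI => //.
  rewrite -[X in measurable X]setTI.
  rewrite -[X in _ `&` X](_ : df_of_quantile G @^-1` `]-oo, y] = _).
    apply: nondecreasing_measurable => //; exact: nondecreasing_df_of_quantile.
  by apply/seteqP; split => x /=; rewrite in_itv.
apply/eqP; rewrite eq_le; apply/andP; split.
- apply: (@le_trans _ _ (lebesgue_measure `[0, G y]%classic)).
    apply: le_measure; rewrite ?inE//.
    move=> x /=; rewrite !in_itv/= => -[/andP[x0 x1] Fx]; rewrite x0/=.
    rewrite -[leLHS](df_of_quantileK x0 x1); apply: ndG; rewrite ?(itvP yI)//.
    by rewrite (itvP (df_of_quantile_in x)).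
  by rewrite lebesgue_measure_itv/= lte_fin sube0; case: ltgtP Gy0 => // <-.
- apply: (@le_trans _ _ (lebesgue_measure `[0, G y[%classic)).
    by rewrite lebesgue_measure_itv/= lte_fin sube0; case: ltgtP Gy0 => // <-.
  apply: le_measure; rewrite ?inE//.
  move=> x /=; rewrite !in_itv/= => /andP[x0 xy]; have x1 : x <= 1 by lra.
  rewrite x0 x1; split => //.
  apply: ge_sup; first exact: (hsS x0).1.
  move=> z [zI Gz]; rewrite leNgt; apply/negP => yz.
  have := @ndG y z; rewrite (itvP yI) (itvP zI) (ltW yz) => /(_ isT isT isT).
  lra.
Qed.

End monotone_inverses.

(** * Quantile pyramids *)

Section pyramid_properties.
Context {R : realType}.

Lemma dyadic_interp_natl m (a : nat -> R) (i : nat) :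
  dyadic_interp m a (i%:R / 2 ^+ m) = a i.
Proof.
rewrite /dyadic_interp [2 ^+ m * _]mulrC divfK ?expf_neq0// natrK subrr subr0.
by rewrite mulr1 mulr0 addr0.
Qed.

(** Let [i] and [k] be the cells of [x] and [y]. If [i < k], the values are separated by
    [a i.+1 <= a k]; if [i = k], the function is affine with nonnegative slope on the cell. *)
Lemma nondecreasing_dyadic_interp m (a : nat -> R) :
  (forall i, (i < 2 ^ m)%N -> a i <= a i.+1) ->
  forall x y : R, 0 <= x -> x <= y -> y <= 1 ->
  dyadic_interp m a x <= dyadic_interp m a y.
Proof.
move=> nda x y x0 xy y1; rewrite /dyadic_interp.
have M0 : 0 < 2 ^+ m :> R by rewrite exprn_gt0.
set X := 2 ^+ m * x; set Y := 2 ^+ m * y.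
have X0 : 0 <= X by rewrite mulr_ge0// ltW.
have XY : X <= Y by rewrite ler_pM2l.
have YM : Y <= (2 ^ m)%N%:R by rewrite natrX -[leRHS]mulr1 ler_pM2l.
have := truncn_itv X0; have := truncn_itv (le_trans X0 XY).
set i := Num.truncn X; set k := Num.truncn Y => /andP[kY Yk] /andP[iX Xi].
have kM : (k <= 2 ^ m)%N by rewrite -(ler_nat R) (le_trans kY).
have ik : (i <= k)%N.
  by rewrite -ltnS -(ltr_nat R); apply: le_lt_trans Yk; exact: le_trans XY.
have ndak p : (i < p <= k)%N -> a i.+1 <= a p.
  elim: p => // p IH /andP[ip pk]; move: ip; rewrite ltnS leq_eqVlt => /predU1P[->//|ip].
  apply: (le_trans (IH _)); first by rewrite ip ltnW.
  by apply: nda; exact: leq_trans kM.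
(* For [k = 2 ^ m], that is [y = 1], nothing is known about [a k.+1], but its weight is 0. *)
have Yge : a k <= a k * (1 - (Y - k%:R)) + a k.+1 * (Y - k%:R).
  move: kM; rewrite leq_eqVlt => /predU1P[kE|/nda ak]; last by rewrite -natr1 in Yk; nra.
  have -> : Y = k%:R by apply/eqP; rewrite eq_le kY andbT kE.
  by rewrite subrr; lra.
move: ik; rewrite leq_eqVlt => /predU1P[ik|ik]; last first.
  apply: le_trans Yge; apply: (@le_trans _ _ (a i.+1)); last by apply: ndak; rewrite ik leqnn.
  have := nda i (leq_trans ik kM); rewrite -natr1 in Xi; nra.
rewrite -ik; move: kM; rewrite leq_eqVlt -ik => /predU1P[iE|/nda ai]; last by nra.
have YE : Y = i%:R by apply/eqP; rewrite eq_le {2}ik kY andbT iE.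
have XE : X = i%:R by apply/eqP; rewrite eq_le iX andbT -YE.
by rewrite YE XE.
Qed.

Variable v : nat -> nat -> R.
Hypothesis v01 : forall m j, is_node m j -> v m j \in `[0, 1].

Lemma pyramid0 m : pyramid v m 0 = 0.
Proof.
elim: m => //= m IH; rewrite -[X in dyadic_interp _ _ X](mul0r (2 ^+ m.+1)^-1).
by rewrite (dyadic_interp_natl m.+1 _ 0)/= mul0r.
Qed.

Lemma pyramid1 m : pyramid v m 1 = 1.
Proof.
elim: m => //= m IH.
have E : (2 ^ m.+1)%N%:R / 2 ^+ m.+1 = 1 :> R by rewrite natrX divff// expf_neq0.
rewrite -[X in dyadic_interp _ _ X]E dyadic_interp_natl.
by rewrite oddX/= E.
Qed.

(** Each new node value is a convex combination of the two neighbouring old values, so the values at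
    the finer nodes remain ordered. *)
Lemma nondecreasing_pyramid m (x y : R) : 0 <= x -> x <= y -> y <= 1 ->
  pyramid v m x <= pyramid v m y.
Proof.
elim: m x y => [//|m IH] x y /= x0 xy y1.
apply: nondecreasing_dyadic_interp => // j jM /=.
have M0 : 0 < 2 ^+ m.+1 :> R by rewrite exprn_gt0.
have ge0 i : 0 <= i%:R / 2 ^+ m.+1 :> R by rewrite divr_ge0// ltW.
have le1 i : (i <= 2 ^ m.+1)%N -> i%:R / 2 ^+ m.+1 <= 1 :> R.
  by move=> iM; rewrite ler_pdivrMr// mul1r -natrX ler_nat.
have nd i p : (i <= p <= 2 ^ m.+1)%N ->
    pyramid v m (i%:R / 2 ^+ m.+1) <= pyramid v m (p%:R / 2 ^+ m.+1).
  by move=> /andP[ip pM]; apply: IH => //; [rewrite ler_pM2r ?invr_gt0// ler_nat|exact: le1].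
have [oj|ej] := boolP (odd j).
  have /v01 : is_node m.+1 j by rewrite /is_node oj jM.
  rewrite in_itv/= => /andP[v0 v1].
  have := nd j.-1 j.+1; rewrite jM andbT (leq_trans (leq_pred _))// => /(_ isT).
  by nra.
(* For even [j] the successor is odd, hence different from [2 ^ m.+1], and is itself a node. *)
have j1M : (j.+1 < 2 ^ m.+1)%N.
  rewrite ltn_neqAle jM andbT; apply/eqP => /(congr1 odd).
  by rewrite oddX/= ej.
have /v01 : is_node m.+1 j.+1 by rewrite /is_node/= ej j1M.
rewrite in_itv/= => /andP[v0 v1].
have := nd j j.+2; rewrite j1M andbT leqW// => /(_ isT).
by nra.
Qed.

Variable Q : R -> R.
Hypothesis Qlim : forall y, y \in `[0, 1] -> pyramid v m y @[m --> \oo] --> Q y.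

Lemma pyramid_limit0 : Q 0 = 0.
Proof.
have : 0 \in `[(0 : R), 1] by rewrite in_itv/= lexx ler01.
move/Qlim; under eq_cvg do rewrite pyramid0.
by move/cvg_lim => <-//; rewrite lim_cst.
Qed.

Lemma pyramid_limit1 : Q 1 = 1.
Proof.
have : 1 \in `[(0 : R), 1] by rewrite in_itv/= lexx ler01.
move/Qlim; under eq_cvg do rewrite pyramid1.
by move/cvg_lim => <-//; rewrite lim_cst.
Qed.

Lemma nondecreasing_pyramid_limit (x y : R) :
  0 <= x -> x <= y -> y <= 1 -> Q x <= Q y.
Proof.
move=> x0 xy y1.
have xI : x \in `[0, 1] by rewrite in_itv/= x0 (le_trans xy).
have yI : y \in `[0, 1] by rewrite in_itv/= y1 (le_trans x0).
apply: ler_cvg_to (Qlim xI) (Qlim yI) _.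
by apply: nearW => m; exact: nondecreasing_pyramid.
Qed.

End pyramid_properties.

(** * Images of the uniform distribution *)

Section measurability.
Context {R : realType}.

(** The inverse is the real power with exponent -1 on nonnegative numbers, extended by oddness. *)
Lemma measurable_invr : measurable_fun setT (@GRing.inv R).
Proof.
rewrite (_ : GRing.inv = fun x : R => if 0 <= x then x `^ (-1) else - ((- x) `^ (-1))).
  apply: measurable_fun_ifT => //=.
    exact: measurable_fun_ler.
  apply: measurableT_comp => //.
  exact: (@measurableT_comp _ _ _ _ _ _ (@powR R ^~ (-1))).
apply/funext => x; case: ifPn => [x0|]; first by rewrite powR_inv1.
by rewrite -ltNge => x0; rewrite powR_inv1 ?oppr_ge0 ?ltW// invrN opprK.
Qed.

Lemma measurable_lne : measurable_fun setT (@lne R).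
Proof.
rewrite (_ : @lne R = fun x : \bar R => if (x <= 0)%E then -oo%E else
    if x == +oo%E then +oo%E else (ln (fine x))%:E).
  apply: measurable_fun_ifT => //=; first exact: measurable_fun_lee.
  apply: measurable_fun_ifT => //=; first exact: measurable_fun_eqe.
  apply/measurable_EFinP; apply: measurableT_comp => //.
by apply/funext => -[x| |] /=; rewrite ?lee_fin ?leNye ?leye_eq ?eqxx.
Qed.

Lemma measurable_EFin_inve d (T : measurableType d) (D : set T) (f : T -> R) :
  measurable D -> measurable_fun D f -> measurable_fun D (fun x => (f x)%:E^-1)%E.
Proof.
move=> mD mf; under eq_fun do rewrite inver.
apply: measurable_fun_if => //.
- under eq_fun do rewrite -eqe; apply: measurable_fun_eqe => //.
  exact/measurable_EFinP.
- apply/measurable_EFinP; apply: (measurable_funS mD); first by move=> x [].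
  by apply: measurableT_comp => //; exact: measurable_invr.
Qed.

End measurability.

Local Instance lebesgue_ae_filter (R : realType) :
  Filter (nbhs (almost_everywhere (@lebesgue_measure R))).
Proof. exact: (@ae_filter_ringOfSetsType _ (measurableTypeR R)). Qed.

(** * Null sets and signed integrals under a transport of the uniform law *)

Section transport_theory.
Context {R : realType}.
Notation mu := (@lebesgue_measure R).
Local Notation D := (`[0%R : R, 1%R]%classic : set R).
Variables (phi r : R -> R).
Hypothesis tr : transports_uniform phi r.
Local Open Scope ereal_scope.

Let mphi : measurable_fun D phi. Proof. by case: tr. Qed.
Let mr : measurable_fun D r. Proof. by case: tr. Qed.
Let phiD (x : R) : x \in `[0%R, 1%R] -> phi x \in `[0%R, 1%R].
Proof. by move: x; case: tr. Qed.
Let r0 (x : R) : x \in `[0%R, 1%R] -> (0 <= r x)%R.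
Proof. by move: x; case: tr. Qed.

Lemma measurable_fun_transport d (T : measurableType d) (g : R -> T) :
  measurable_fun D g -> measurable_fun D (g \o phi).
Proof.
by move=> mg; apply: measurable_comp mg mphi => // _ [x /phiD xD <-].
Qed.

(** The integral of the nonnegative function [g \o phi] equals that of [g * r], which is 0. Taking
    for [g] the indicator of a null set, or of the zero set of [r], gives the next two lemmas. *)
Let ae_comp_eq0 (g : R -> R) : measurable_fun D g -> (forall x, (0 <= g x)%R) ->
  {ae mu, forall x, D x -> (g x * r x = 0)%R} ->
  {ae mu, forall x, D x -> (g (phi x) = 0)%R}.
Proof.
move=> mg g0 gr0.
have mgE : measurable_fun D (EFin \o g) by exact/measurable_EFinP.
have mgp : measurable_fun D (fun x => (g (phi x))%:E).
  by apply/measurable_EFinP; exact: measurable_fun_transport.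
have : ae_eq mu D (fun x => (g (phi x))%:E) (cst 0).
  apply/ae_eq_integral_abs => //.
  under eq_integral do rewrite gee0_abs ?lee_fin//.
  rewrite (ge0_integral_transport tr (g := EFin \o g))//; last first.
    by move=> x _; rewrite lee_fin.
  rewrite (ae_eq_integral (cst 0)) ?integral0//.
    by apply: emeasurable_funM => //; exact/measurable_EFinP.
  by apply: filterS gr0 => x /[apply] /= gr; rewrite -EFinM gr.
by apply: filterS => x /[apply] -[].
Qed.

Lemma ae_transport (P : R -> Prop) : {ae mu, forall u, D u -> P u} ->
  {ae mu, forall x, D x -> P (phi x)}.
Proof.
move=> [N [mN N0 PN]].
have : {ae mu, forall x, D x -> (\1_N (phi x) = 0 :> R)%R}.
  apply: (ae_comp_eq0 (g := \1_N)); [exact: measurable_indic|by []|].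
  exists N; split => // x /= /not_implyP[_ h].
  by apply: contrapT => Nx; apply: h; rewrite indicE memNset// mul0r.
apply: filterS => x h Dx; apply: contrapT => nP.
have : N (phi x) by apply: PN => /= H; apply: nP; apply: H; exact: phiD.
move=> /mem_set Nx; move: (h Dx); rewrite indicE Nx /= => /eqP.
by rewrite oner_eq0.
Qed.

Lemma ae_transport_gt0 : {ae mu, forall x, D x -> (0 < r (phi x))%R}.
Proof.
have : {ae mu, forall x, D x -> ((r (phi x) == 0)%:R = 0 :> R)%R}.
  apply: (ae_comp_eq0 (g := fun x => (r x == 0)%:R%R)) => //.
    rewrite (_ : (fun _ => _) = fun x => if r x == 0%R then 1%R else 0%R : R); last first.
      by apply/funext => x; case: (r x == 0%R).
    apply: measurable_fun_if => //.
    exact: measurable_fun_eqr.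
  apply: aeW => x _; have [->|] := eqVneq (r x) 0%R; first by rewrite mulr0.
  by rewrite mul0r.
apply: filterS => x h Dx; have := r0 (phiD Dx).
rewrite le_eqVlt => /predU1P[rx|//]; have := h Dx; rewrite -rx eqxx => /eqP.
by rewrite oner_eq0.
Qed.

(** Positive and negative parts are transported separately, so the identity includes infinite
    integrals. *)
Lemma integral_transport (g : R -> R) : measurable_fun D g ->
  \int[mu]_(x in D) (g (phi x))%:E = \int[mu]_(x in D) (g x * r x)%:E.
Proof.
move=> mg; rewrite integralE [RHS]integralE.
have mgE : measurable_fun D (EFin \o g) by exact/measurable_EFinP.
congr (_ - _).
- transitivity (\int[mu]_(x in D) (EFin \o g)^\+ (phi x)).
    by apply: eq_integral => x _; rewrite !funeposE.
  rewrite (ge0_integral_transport tr (g := (EFin \o g)^\+))//; last exact: measurable_funepos.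
  apply: eq_integral => x /set_mem/r0 rx. 
  by rewrite !funeposE /= -EFin_max -EFinM maxr_pMl// mul0r EFin_max.
- transitivity (\int[mu]_(x in D) (EFin \o g)^\- (phi x)).
    by apply: eq_integral => x _; rewrite !funenegE.
  rewrite (ge0_integral_transport tr (g := (EFin \o g)^\-))//; last exact: measurable_funeneg.
  apply: eq_integral => x /set_mem/r0 rx.
  by rewrite !funenegE /= -EFin_max -EFinM maxr_pMl// mulNr mul0r EFin_max.
Qed.

End transport_theory.

(** * The distribution and quantile functions of a bounded density *)

Section bounded_density.
Context {R : realType}.
Notation mu := (@lebesgue_measure R).
Local Notation D := (`[0%R : R, 1%R]%classic : set R).
Variables (f : R -> R) (K : R).
Hypotheses (fd : is_density01 f) (fK : forall x, x \in `[0, 1] -> f x <= K).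
Let F := df_of_density f.

Let mf : measurable_fun D f. Proof. by case: fd. Qed.
Let f0 (x : R) : x \in `[0, 1] -> 0 <= f x. Proof. by move: x; case: fd. Qed.
Let intf : (\int[mu]_(x in D) (f x)%:E = 1)%E. Proof. by case: fd. Qed.

Let mfE : measurable_fun D (EFin \o f). Proof. exact/measurable_EFinP. Qed.

Lemma integrable_density01 : mu.-integrable D (EFin \o f).
Proof.
apply/integrableP; split => //.
rewrite (_ : (\int[mu]_(x in D) _)%E = 1%E) ?ltry// -intf.
by apply: eq_integral => x /set_mem xD /=; rewrite ger0_norm// f0.
Qed.

Lemma df_of_densityE x : ((F x)%:E = \int[mu]_(t in D `&` `]-oo, x]) (f t)%:E)%E.
Proof.
rewrite /F /df_of_density /Rintegral fineK//.
apply: integrable_fin_num; first exact: measurableI.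
by apply: integrableS integrable_density01 => //; exact: measurableI.
Qed.

Lemma df_of_density0 : F 0 = 0.
Proof.
apply: EFin_inj; rewrite df_of_densityE; apply: (@integral_Sset1 R _ _ 0) => x /= [].
by rewrite !in_itv/= => /andP[x0 _] x0'; apply/eqP; rewrite eq_le x0 andbT.
Qed.

Lemma df_of_density1 : F 1 = 1.
Proof.
apply: EFin_inj; rewrite df_of_densityE -[RHS]intf; congr (\int[mu]_(x in _) _)%E.
by apply: setIidl => x /=; rewrite !in_itv/= => /andP[].
Qed.

Let FB x y : 0 <= x -> x <= y -> y <= 1 ->
  ((F y)%:E = (F x)%:E + \int[mu]_(t in `]x, y]) (f t)%:E)%E.
Proof.
move=> x0 xy y1; rewrite !df_of_densityE.
have sub (a : R) : a <= 1 -> D `&` `]-oo, a] = `[0, a]%classic.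
  move=> a1; apply/seteqP; split => t /=; rewrite !in_itv/=.
    by move=> [/andP[-> _] ->].
  by move=> /andP[t0 ta]; rewrite t0 ta (le_trans ta).
rewrite !sub ?(le_trans xy)// -ge0_integral_setU//=.
- congr (\int[mu]_(x in _) _)%E.
  by apply: itv_bndbnd_setU; rewrite bnd_simp.
- apply: (measurable_funS _ _ mfE) => // t /=; rewrite !in_itv/=.
  move=> [/andP[t0 tx]|/andP[xt ty]]; first by rewrite t0 (le_trans tx)// (le_trans xy).
  by rewrite (le_trans ty)// andbT (le_trans x0)// ltW.
- move=> t /= h; rewrite lee_fin f0//; move: h; rewrite !in_itv/=.
  move=> [/andP[t0 tx]|/andP[xt ty]]; first by rewrite t0 (le_trans tx)// (le_trans xy).
  by rewrite (le_trans ty)// andbT (le_trans x0)// ltW.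
- apply/disj_setPS => t /= []; rewrite !in_itv/= => /andP[_ tx] /andP[xt _].
  by move: (lt_le_trans xt tx); rewrite ltxx.
Qed.

Lemma nondecreasing_df_of_density x y : 0 <= x -> x <= y -> y <= 1 -> F x <= F y.
Proof.
move=> x0 xy y1; rewrite -lee_fin (FB x0 xy y1) leeDl//.
apply: integral_ge0 => t /=; rewrite in_itv/= => /andP[xt ty].
by rewrite lee_fin f0// in_itv/= (le_trans ty)// andbT (le_trans x0)// ltW.
Qed.

Lemma df_of_density_lipschitz x y : 0 <= x -> x <= y -> y <= 1 ->
  F y - F x <= K * (y - x).
Proof.
move=> x0 xy y1; rewrite lerBlDl -lee_fin (FB x0 xy y1) EFinD leeD2l//.
have sub t : `]x, y]%classic t -> t \in `[0, 1].
  rewrite /= !in_itv/= => /andP[xt ty].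
  by rewrite (le_trans ty)// andbT (le_trans x0)// ltW.
apply: (@le_trans _ _ (\int[mu]_(t in `]x, y]) (cst K%:E) t)%E).
  apply: ge0_le_integral => //.
  - by move=> t /sub tD; rewrite lee_fin f0.
  - by apply: (measurable_funS _ _ mfE) => // t /sub.
  - by move=> t /sub tD; rewrite lee_fin fK.
rewrite integral_cst//= lebesgue_measure_itv/= lte_fin; case: ltgtP xy => //.
  by move=> -> _; rewrite subrr mulr0 mule0.
Qed.

Let K0 : 0 <= K.
Proof.
have D0 : 0 \in `[(0 : R), 1] by rewrite in_itv/= lexx ler01.
exact: le_trans (f0 D0) (fK D0).
Qed.

Lemma df_of_density_unif_continuous e : 0 < e -> exists2 t : R, 0 < t &
  forall x y : R, 0 <= x -> x <= y -> y <= 1 -> y - x < t -> F y - F x < e.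
Proof.
(* [K + 1] is positive given [0 <= K], so the division is safe. *)
move=> e0; exists (e / (K + 1)); first by rewrite divr_gt0// ltr_wpDl.
move=> x y x0 xy y1 yx; apply: le_lt_trans (df_of_density_lipschitz x0 xy y1) _.
move: yx; rewrite ltr_pdivlMr ?ltr_wpDl//; nra.
Qed.

Let Q := quantile01 F.

Lemma transports_uniform_quantile01 : transports_uniform Q f.
Proof.
have uc := df_of_density_unif_continuous.
have nd := nondecreasing_df_of_density.
split => //.
- exact: (measurable_quantile01 df_of_density0 df_of_density1 nd uc).
- by move=> u /itvP uI; apply: quantile01_in df_of_density1 _ _; rewrite uI.
- move=> y yI; rewrite -df_of_densityE.
  exact: (lebesgue_measure_quantile01_le df_of_density0 df_of_density1 nd uc).
Qed.

End bounded_density.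

(** * The random quantile function, its density and the density of its inverse *)

Section quantile_function.
Context {R : realType}.
Notation mu := (@lebesgue_measure R).
Local Notation D := (`[0%R : R, 1%R]%classic : set R).
Variables (Q q : R -> R).
Hypotheses (Q0 : Q 0 = 0) (Q1 : Q 1 = 1).
Hypothesis ndQ : forall x y : R, 0 <= x -> x <= y -> y <= 1 -> Q x <= Q y.
Hypothesis cQ : forall e : R, 0 < e -> exists2 t : R, 0 < t &
  forall x y : R, 0 <= x -> x <= y -> y <= 1 -> y - x < t -> Q y - Q x < e.
Hypothesis Qder : {ae mu, forall u, u \in `[(0 : R), 1] -> is_derive u 1 Q (q u)}.
Hypothesis iq : mu.-integrable D (EFin \o q).
Hypothesis Qint : forall y, y \in `[0, 1] ->
  ((Q y)%:E = \int[mu]_(u in `[0%R, y]) (q u)%:E)%E.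
Let F := df_of_quantile Q.

Let mq : measurable_fun D q.
Proof. by apply/measurable_EFinP; exact: measurable_int iq. Qed.

Lemma ae_neq (a : R) : {ae mu, forall x : R, x != a}.
Proof.
exists [set a]; split => //; first exact: lebesgue_measure_set1.
by move=> x /= /negP; rewrite negbK => /eqP.
Qed.

(** Derivatives are two-sided while monotonicity and inversion hold on [0,1] only; discarding the
    endpoints leaves room for a neighbourhood. *)
Lemma ae_interior (P : R -> Prop) :
  {ae mu, forall x : R, x \in `]0, 1[ -> P x} ->
  {ae mu, forall x : R, x \in `[0, 1] -> P x}.
Proof.
move=> h; have := ae_neq 0; have := ae_neq 1.
apply: filterS3 h => x Px x1 x0; rewrite in_itv/= => /andP[x0' x1'].
by apply: Px; rewrite in_itv/= !lt_neqAle x0' x1' x1 eq_sym x0.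
Qed.

Lemma is_derive_ge0 (u l : R) : u \in `]0, 1[ -> is_derive u 1 Q l -> 0 <= l.
Proof.
rewrite in_itv/= => /andP[u0 u1] [dQ <-]; apply: limr_ge => //.
near=> h; rewrite /= /shift/= [h *: 1]mulr1.
have hu : `|h| < Num.min u (1 - u).
  by near: h; apply: dnbhs0_lt; rewrite lt_min u0 subr_gt0.
have h0 : h != 0 by near: h; exact: nbhs_dnbhs_neq.
move: hu; rewrite lt_min !ltr_norml => /andP[/andP[hu0 _] /andP[_ hu1]].
rewrite [_ *: _]mulrC; have [h_lt0|h_gt0|hE] := ltgtP h 0; last by rewrite hE eqxx in h0.
  by apply: mulr_le0; rewrite ?invr_le0 ?(ltW h_lt0)// subr_le0; apply: ndQ; lra.
by apply: divr_ge0; rewrite ?(ltW h_gt0)// subr_ge0; apply: ndQ; lra.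
Unshelve. all: by end_near. Qed.

Lemma ae_quantile_density_ge0 : {ae mu, forall u : R, u \in `[0, 1] -> 0 <= q u}.
Proof.
apply: ae_interior; apply: filterS Qder => u h uI.
have uD : u \in `[(0 : R), 1] by move: uI; rewrite !in_itv/= => /andP[/ltW-> /ltW->].
exact: is_derive_ge0 uI (h uD).
Qed.

(** [transports_uniform] asks for a density that is nonnegative at every point of [0,1], whereas [q]
    is so almost everywhere; its positive part is used instead. *)
Lemma ae_quantile_density_max :
  {ae mu, forall u : R, u \in `[0, 1] -> q u = Num.max (q u) 0}.
Proof.
by apply: filterS ae_quantile_density_ge0 => u /[apply] q0; rewrite (max_idPl q0).
Qed.

Lemma measurable_quantile_density_max : measurable_fun D (fun u => Num.max (q u) 0).
Proof. exact: measurable_maxr. Qed.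

Lemma integral_quantile_density y : y \in `[0, 1] ->
  (\int[mu]_(u in D `&` `]-oo, y]) (Num.max (q u) 0)%:E = (Q y)%:E)%E.
Proof.
move=> yI; rewrite Qint//.
have -> : D `&` `]-oo, y] = `[0, y]%classic.
  move: yI; rewrite in_itv/= => /andP[y0 y1].
  apply/seteqP; split => t /=; rewrite !in_itv/=.
    by move=> [/andP[-> _] ->].
  by move=> /andP[t0 ta]; rewrite t0 ta (le_trans ta).
have sub : `[0, y]%classic `<=` D.
  move=> t /=; rewrite !in_itv/= => /andP[-> ty].
  by rewrite (le_trans ty)// (itvP yI).
apply: ae_eq_integral => //.
- by apply/measurable_EFinP; exact: measurable_funS measurable_quantile_density_max.
- by apply/measurable_EFinP; exact: measurable_funS mq.
- by apply: filterS ae_quantile_density_max => u h /sub/h <-.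
Qed.

Lemma measurable_df_of_quantile : measurable_fun setT F.
Proof.
apply: nondecreasing_measurable => //; exact: nondecreasing_df_of_quantile.
Qed.

Lemma transports_uniform_df_of_quantile :
  transports_uniform F (fun u => Num.max (q u) 0).
Proof.
split.
- by apply: measurable_funTS; exact: measurable_df_of_quantile.
- by move=> x _; exact: df_of_quantile_in.
- exact: measurable_quantile_density_max.
- by move=> x _; rewrite le_max lexx orbT.
- move=> y yI; rewrite integral_quantile_density//.
  exact: (lebesgue_measure_df_of_quantile_le Q0 Q1 ndQ cQ).
Qed.

(** The chain rule for [Q \o F = id] gives [q (F x) * f x = 1]. It applies for almost every [x]: the
    law of [F] under the uniform measure has a density, so [Q] is differentiable at [F x] and
    [q (F x) > 0] almost everywhere. *)
Lemma ae_derivative_version (f : R -> R) : is_derivative_version F f ->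
  {ae mu, forall x : R, x \in `[0, 1] ->
    [/\ 0 < Num.max (q (F x)) 0 & f x = (Num.max (q (F x)) 0)^-1]}.
Proof.
move=> [mf Fder]; have tr := transports_uniform_df_of_quantile.
have pos := ae_transport_gt0 tr.
have der := ae_transport tr Qder.
apply: ae_interior.
apply: filterS3 Fder pos der => x Fx qpos Qx xI.
have xD : x \in `[(0 : R), 1] by move: xI; rewrite !in_itv/= => /andP[/ltW-> /ltW->].
split; first exact: qpos.
have := qpos xD; rewrite lt_max ltxx orbF => qx; rewrite (max_idPl (ltW qx)).
have QF : is_derive x 1 (Q \o F) (q (F x) * f x).
  by apply: is_derive1_comp; [exact: Qx xD|exact: Fx].
have : is_derive x 1 (@id R) (q (F x) * f x).
  apply: near_eq_is_derive QF; near=> t; rewrite /=.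
  have : t \in `]0, 1[ by near: t; exact: near_in_itvoo.
  rewrite in_itv/= => /andP[t0 t1].
  by apply: df_of_quantileK => //; exact: ltW.
move=> [_]; rewrite derive_id => /(congr1 (fun z => (q (F x))^-1 * z)).
by rewrite mulr1 mulKf ?gt_eqF.
Unshelve. all: by end_near. Qed.

End quantile_function.

(** * Kullback-Leibler bounds *)

Section kullback_leibler.
Context {R : realType}.
Notation mu := (@lebesgue_measure R).
Local Notation D := (`[0%R : R, 1%R]%classic : set R).
Variables (f0 : R -> R) (K : R).
Hypotheses (f0d : is_density01 f0) (f0K : forall x, x \in `[0, 1] -> f0 x <= K).
Let F0 := df_of_density f0.
Let Q0 := quantile01 F0.
(** Real-valued version of [quantile_density f0]: it is 0 instead of +oo where [f0 (Q0 u) = 0], a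
    null set by [f0Q0_gt0]. *)
Let q0 u := (f0 (Q0 u))^-1.

Let trQ0 : transports_uniform Q0 f0. Proof. exact: transports_uniform_quantile01 f0d f0K. Qed.
Let mf0 : measurable_fun D f0. Proof. by case: f0d. Qed.
Let f0_ge0 (x : R) : x \in `[0, 1] -> 0 <= f0 x. Proof. by move: x; case: f0d. Qed.
Let Q0D (u : R) : u \in `[0, 1] -> Q0 u \in `[0, 1]. Proof. by move: u; case: trQ0. Qed.

Let nd := nondecreasing_df_of_density f0d.
Let uc := df_of_density_unif_continuous f0d f0K.
Let F00 := df_of_density0 f0d.
Let F01 := df_of_density1 f0d.

Let F0Q0 (u : R) : u \in `[0, 1] -> F0 (Q0 u) = u.
Proof. by move=> /itvP uI; apply: (quantile01K F00 F01 uc); rewrite uI. Qed.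

Let mf0Q0 : measurable_fun D (f0 \o Q0).
Proof. exact: measurable_fun_transport trQ0 _ _ _ mf0. Qed.

Let mq0 : measurable_fun D q0.
Proof. exact: (measurableT_comp measurable_invr mf0Q0). Qed.

Let q0_ge0 (u : R) : u \in `[0, 1] -> 0 <= q0 u.
Proof. by move=> uI; rewrite invr_ge0 f0_ge0// Q0D. Qed.

Let f0Q0_gt0 : {ae mu, forall u : R, D u -> 0 < f0 (Q0 u)}.
Proof. exact: ae_transport_gt0 trQ0. Qed.

Let zero (x : R) : R := (f0 x == 0)%:R.

Let mzero : measurable_fun D zero.
Proof.
rewrite (_ : zero = fun x => if f0 x == 0 then 1 else 0); last first.
  by apply/funext => x; rewrite /zero; case: (f0 x == 0).
by apply: measurable_fun_if => //; exact: measurable_fun_eqr.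
Qed.

(* [f0] may vanish on a set of positive measure, and the integral of [q0] misses
   the part of that set in [0, Q0 v]. *)
Let integral_q0 (v : R) : v \in `[0, 1] ->
  (\int[mu]_(u in `[0%R, v]) (q0 u)%:E + \int[mu]_(x in `[0%R, Q0 v]) (zero x)%:E =
   (Q0 v)%:E)%E.
Proof.
move=> vI; have Q0vI := Q0D vI.
have sub (a : R) : a \in `[0, 1] -> `[0, a]%classic `<=` D.
  move=> aI t /=; rewrite !in_itv/= => /andP[-> ta].
  by rewrite (le_trans ta)// (itvP aI).
(* [g (Q0 u)] is [q0 u] for [u <= v] and 0 beyond, while [g * f0] is the indicator of the points of
   [[0, Q0 v]] where [f0] is nonzero. *)
pose g (x : R) := (f0 x)^-1 * \1_(`[0, Q0 v]%classic) x.
have mg : measurable_fun D g.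
  apply: measurable_funM; last exact: measurable_indic.
  exact: (measurableT_comp measurable_invr mf0).
have g0 (x : R) : x \in `[0, 1] -> (0 <= (g x)%:E)%E.
  by move=> xI; rewrite lee_fin mulr_ge0// invr_ge0 f0_ge0.
have -> : (\int[mu]_(u in `[0%R, v]) (q0 u)%:E = \int[mu]_(u in D) (g (Q0 u))%:E)%E.
  rewrite (_ : `[0, v]%classic = D `&` `[0, v]%classic); last first.
    by apply/esym/setIidr; exact: sub.
  rewrite integral_mkcondr; apply: eq_integral => u /set_mem uI.
  rewrite /g patchE indicE !mem_setE !in_itv/= !(itvP uI) !(itvP (Q0D uI)) /=.
  have -> : (Q0 u <= Q0 v) = (u <= v).
    rewrite -[in RHS](F0Q0 vI).
    by apply: (quantile01_le F00 F01 nd uc _ _ Q0vI); rewrite (itvP uI).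
  by case: ifPn => _; rewrite ?mulr1 ?mulr0.
rewrite (ge0_integral_transport trQ0 (g := EFin \o g))//; last exact/measurable_EFinP.
have -> : (\int[mu]_(x in D) ((EFin \o g) x * (f0 x)%:E) =
    \int[mu]_(x in `[0%R, Q0 v]) (1 - zero x)%R%:E)%E.
  rewrite (_ : `[0, Q0 v]%classic = D `&` `[0, Q0 v]%classic); last first.
    by apply/esym/setIidr; exact: sub.
  rewrite integral_mkcondr; apply: eq_integral => x _.
  rewrite [X in (X * _)%E]/= /g /zero patchE indicE; case: ifPn => _; last by rewrite mulr0 mul0e.
  rewrite mulr1 -EFinM; have [->|fx0] := eqVneq (f0 x) 0; first by rewrite mulr0 subrr.
  by rewrite mulVf// subr0.
have mz : measurable_fun `[0, Q0 v] zero by apply: measurable_funS mzero => //; exact: sub.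
rewrite -ge0_integralD//=.
- under eq_integral do rewrite -EFinD subrK.
  rewrite integral_cst//= mul1e lebesgue_measure_itv/= lte_fin sube0.
  have : 0 <= Q0 v by rewrite (itvP Q0vI).
  by case: ltgtP => // <-.
- by move=> x _; rewrite lee_fin /zero; case: (f0 x == 0); rewrite ?subrr ?subr0.
- by apply/measurable_EFinP; apply: measurable_funB.
- by move=> x _; rewrite lee_fin /zero; case: (f0 x == 0).
- exact/measurable_EFinP.
Qed.

Variables (Q q : R -> R).
Hypotheses (Q_0 : Q 0 = 0) (Q_1 : Q 1 = 1).
Hypothesis ndQ : forall x y : R, 0 <= x -> x <= y -> y <= 1 -> Q x <= Q y.
Hypothesis ucQ : forall e : R, 0 < e -> exists2 t : R, 0 < t &
  forall x y : R, 0 <= x -> x <= y -> y <= 1 -> y - x < t -> Q y - Q x < e.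
Hypothesis Qder : {ae mu, forall u, u \in `[(0 : R), 1] -> is_derive u 1 Q (q u)}.
Hypothesis iq : mu.-integrable D (EFin \o q).
Hypothesis Qint : forall y, y \in `[0, 1] ->
  ((Q y)%:E = \int[mu]_(u in `[0%R, y]) (q u)%:E)%E.
Let F := df_of_quantile Q.
Let qp u := Num.max (q u) 0.

Let trF : transports_uniform F qp.
Proof. exact: transports_uniform_df_of_quantile Q_0 Q_1 ndQ ucQ Qder iq Qint. Qed.

Let mqp : measurable_fun D qp. Proof. exact: measurable_quantile_density_max iq. Qed.
Let qp_ge0 u : 0 <= qp u. Proof. by rewrite le_max lexx orbT. Qed.
Let FD (x : R) : F x \in `[0, 1]. Proof. exact: df_of_quantile_in. Qed.

Let dist u := `|qp u - q0 u|.
Let mdist : measurable_fun D dist.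
Proof. by apply: measurableT_comp => //; exact: measurable_funB. Qed.

Let DE (y : R) : y \in `[0, 1] -> D `&` `]-oo, y] = `[0, y]%classic.
Proof.
rewrite in_itv/= => /andP[y0 y1].
apply/seteqP; split => t /=; rewrite !in_itv/=.
  by move=> [/andP[-> _] ->].
by move=> /andP[t0 ta]; rewrite t0 ta (le_trans ta).
Qed.

Let Dsub (y : R) : y \in `[0, 1] -> `[0, y]%classic `<=` D.
Proof. by move=> /DE <-; exact: subIsetl. Qed.

Let D1 : 1 \in `[(0 : R), 1]. Proof. by rewrite in_itv/= lexx ler01. Qed.

Let integral_qp (y : R) : y \in `[0, 1] ->
  (\int[mu]_(u in `[0%R, y]) (qp u)%:E = (Q y)%:E)%E.
Proof. by move=> yI; rewrite -(DE yI); exact: integral_quantile_density. Qed.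

Let integral_le_dist (a b : R -> R) (y : R) : y \in `[0, 1] ->
  measurable_fun D a -> measurable_fun D b ->
  (forall u, u \in `[0, 1] -> 0 <= a u) -> (forall u, u \in `[0, 1] -> 0 <= b u) ->
  (forall u, a u <= b u + dist u) ->
  (\int[mu]_(u in `[0%R, y]) (a u)%:E <=
    \int[mu]_(u in `[0%R, y]) (b u)%:E + \int[mu]_(u in D) (dist u)%:E)%E.
Proof.
move=> yI ma mb a0 b0 ab; have sub := Dsub yI.
have mS (g : R -> R) : measurable_fun D g -> measurable_fun `[0, y] (EFin \o g).
  by move=> mg; apply/measurable_EFinP; exact: measurable_funS mg.
apply: (@le_trans _ _ (\int[mu]_(u in `[0%R, y]) ((b u)%:E + (dist u)%:E))%E).
  apply: ge0_le_integral => //.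
  - by move=> u /sub uI; rewrite lee_fin a0.
  - exact: mS.
  - by apply: emeasurable_funD; exact: mS.
  - by move=> u _; rewrite -EFinD lee_fin ab.
rewrite ge0_integralD//.
- rewrite leeD2l//; apply: ge0_subset_integral => //; first exact/measurable_EFinP.
  by move=> u _; rewrite lee_fin normr_ge0.
- by move=> u /sub uI; rewrite lee_fin b0.
- exact: mS.
- by move=> u _; rewrite lee_fin normr_ge0.
- exact: mS.
Qed.

Let qp_le u : qp u <= q0 u + dist u.
Proof. by rewrite -lerBlDl ler_norm. Qed.

Let q0_le u : q0 u <= qp u + dist u.
Proof. by rewrite -lerBlDl /dist distrC ler_norm. Qed.

(** One [s] bounds the distance from [Q v] to the integral of [q0] up to [v]. The other bounds the
    deficit [z] of that integral: [z <= z1], and the integral of [q0] over [0,1] is at least [1 - s]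
    and at most [1 - z1]. *)
Lemma quantile_functions_close (s v : R) :
  (\int[mu]_(u in D) (dist u)%:E <= s%:E)%E -> v \in `[0, 1] ->
  `|Q v - Q0 v| <= 2 * s.
Proof.
move=> ds vI.
have := integral_q0 vI; have := integral_q0 D1.
set z := (\int[mu]_(x in `[0%R, Q0 v]) (zero x)%:E)%E.
set z1 := (\int[mu]_(x in `[0%R, Q0 1]) (zero x)%:E)%E.
have zero0 x : (0 <= (zero x)%:E)%E by rewrite lee_fin /zero; case: (_ == _).
have zz1 : (z <= z1)%E.
  apply: ge0_subset_integral => //.
  - apply/measurable_EFinP; apply: measurable_funS mzero => //; exact: Dsub (Q0D D1).
  - move=> x /=; rewrite !in_itv/= => /andP[-> xv]; rewrite (le_trans xv)//.
    by apply: (nondecreasing_quantile01 F00 F01 nd uc); rewrite ?(itvP vI)//.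
have := integral_le_dist vI mqp mq0 (fun u _ => qp_ge0 u) q0_ge0 qp_le.
have := integral_le_dist vI mq0 mqp q0_ge0 (fun u _ => qp_ge0 u) q0_le.
have := integral_le_dist D1 mqp mq0 (fun u _ => qp_ge0 u) q0_ge0 qp_le.
rewrite !integral_qp// Q_1.
have := Q0D D1; rewrite in_itv/= => /andP[_ Q01].
have : (0 <= \int[mu]_(u in D) (dist u)%:E)%E.
  by apply: integral_ge0 => u _; rewrite lee_fin normr_ge0.
have : (0 <= \int[mu]_(u in `[0%R, v]) (q0 u)%:E)%E.
  by apply: integral_ge0 => u /(Dsub vI) uI; rewrite lee_fin q0_ge0.
have : (0 <= \int[mu]_(u in `[0%R, 1%R]) (q0 u)%:E)%E.
  by apply: integral_ge0 => u uI; rewrite lee_fin q0_ge0.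
have : (0 <= z)%E by exact: integral_ge0.
move: ds zz1.
move: (\int[mu]_(u in D) (dist u)%:E)%E z z1 (\int[mu]_(u in `[0%R, v]) (q0 u)%:E)%E
  (\int[mu]_(u in `[0%R, 1%R]) (q0 u)%:E)%E => -[i| |] [z| |] [z1| |] [A| |] [B| |] //=.
rewrite -!EFinD !lee_fin => ? ? ? ? ? ? ? ? ? [?] [?].
by rewrite ler_norml; apply/andP; split; lra.
Qed.

Lemma transport_map_close (s u : R) :
  (\int[mu]_(u in D) (dist u)%:E <= s%:E)%E -> u \in `[0, 1] ->
  `|F (Q0 u) - u| <= K * (2 * s).
Proof.
move=> ds uI; have xI := Q0D uI; have vI := FD (Q0 u).
have QvE : Q (F (Q0 u)) = Q0 u by apply: df_of_quantileK => //; rewrite (itvP xI).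
have := quantile_functions_close ds vI; rewrite QvE.
have -> : F (Q0 u) - u = F0 (Q0 (F (Q0 u))) - F0 (Q0 u) by rewrite !F0Q0.
move: (Q0D vI) xI; rewrite -/F; move: (Q0 (F (Q0 u))) => y yI xI xy.
move: xI xy; move: (Q0 u) => x xI xy.
have K0 : 0 <= K by exact: le_trans (f0_ge0 D1) (f0K D1).
have lip a b : 0 <= a -> a <= b -> b <= 1 -> `|F0 b - F0 a| <= K * `|b - a|.
  move=> a0 ab b1; rewrite !ger0_norm ?subr_ge0//; last exact: nd.
  exact: (df_of_density_lipschitz f0d f0K).
apply: (@le_trans _ _ (K * `|x - y|)); last by rewrite ler_wpM2l.
have [h|/ltW h] := leP x y; last by rewrite distrC lip ?(itvP xI) ?(itvP yI).
by rewrite [`|x - y|]distrC lip ?(itvP xI) ?(itvP yI).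
Qed.

Let klq u := qp u * ln (qp u / q0 u).

Let mklq : measurable_fun D klq.
Proof.
apply: measurable_funM => //; apply: measurableT_comp => //.
by apply: measurable_funM => //; exact: (measurableT_comp measurable_invr mq0).
Qed.

(** The extended and the real integrand treat zeros of [f0 \o Q0] differently, but these form a null
    set; where [qp] vanishes both are 0. *)
Let KL01_klq :
  (KL01 q (quantile_density f0) = \int[mu]_(u in D) (klq u)%:E)%E.
Proof.
rewrite /KL01 (_ : (fun u => _) =
    (fun u => (q u)%:E * lne (q u * f0 (Q0 u))%:E)%E); last first.
  by apply/funext => u; rewrite inveK EFinM.
apply: ae_eq_integral => //.
- apply: emeasurable_funM; first exact: measurable_int iq.
  apply: measurableT_comp; first exact: measurable_lne.
  apply/measurable_EFinP; apply: measurable_funM => //.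
  by apply/measurable_EFinP; exact: measurable_int iq.
- exact/measurable_EFinP.
- have qE := ae_quantile_density_max ndQ Qder.
  apply: filterS2 qE f0Q0_gt0 => u qE f0u uI.
  rewrite qE// -/(qp u) /klq /q0 invrK.
  have := qp_ge0 u; rewrite le_eqVlt => /predU1P[<-|qp0].
    by rewrite !mul0r mul0e.
  by rewrite lne_EFin ?mulr_gt0 ?f0u// EFinM.
Qed.

Let mD : measurable D. Proof. exact: measurable_itv. Qed.

Let addl_le (a h : R -> R) : measurable_fun D h ->
  (forall x, x \in `[0, 1] -> 0 <= a x) -> mu.-integrable D (EFin \o a) ->
  (\int[mu]_(x in D) (a x + h x)%:E <=
   \int[mu]_(x in D) (a x)%:E + \int[mu]_(x in D) (h x)%:E)%E.
Proof. exact: (@integral_addl_le _ (measurableTypeR R) R mu D mD). Qed.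

Let integral_q0_le1 : (\int[mu]_(u in D) (q0 u)%:E <= 1)%E.
Proof.
apply: (@le_trans _ _ (Q0 1)%:E); last by rewrite lee_fin (itvP (Q0D D1)).
rewrite -(integral_q0 D1) leeDl//; apply: integral_ge0 => x _.
by rewrite lee_fin /zero; case: (_ == _).
Qed.

Let integrable_of_le (g : R -> R) (c : R) : measurable_fun D g ->
  (forall x, x \in `[0, 1] -> 0 <= g x) -> (\int[mu]_(x in D) (g x)%:E <= c%:E)%E ->
  mu.-integrable D (EFin \o g).
Proof.
move=> mg g0 gc; apply/integrableP; split; first exact/measurable_EFinP.
rewrite (_ : (\int[mu]_(x in D) _)%E = (\int[mu]_(x in D) (g x)%:E)%E).
  exact: le_lt_trans gc (ltry _).
by apply: eq_integral => x /set_mem xI /=; rewrite ger0_norm// g0.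
Qed.

(** A form of Pinsker's inequality. With [I] the L1 distance, integrating [normr_sub_le_mulr_ln_div]
    gives [2 s I + 1 <= (4 s^2 + 1) + 2 s^2], where [qp] has integral 1 and [q0] at most 1. *)
Lemma integral_dist_le (s : R) : 0 < s ->
  (KL01 q (quantile_density f0) < (2 * s ^+ 2)%:E)%E ->
  (\int[mu]_(u in D) (dist u)%:E <= (3 * s)%:E)%E.
Proof.
move=> s0; rewrite KL01_klq => kls.
have ds0 : 0 <= 2 * s by rewrite mulr_ge0// ltW.
(* The terms of the pointwise inequality are arranged as [2 s dist + qp <= a + klq], so that every
   term but [klq] is nonnegative. *)
pose a u := 2 * s ^+ 2 * qp u + (2 * s ^+ 2 + 1) * q0 u.
have s2 : 0 <= 2 * s ^+ 2 by rewrite mulr_ge0// sqr_ge0.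
have s21 : 0 <= 2 * s ^+ 2 + 1 by rewrite addr_ge0.
have a0 u : u \in `[0, 1] -> 0 <= a u.
  by move=> uI; rewrite addr_ge0// mulr_ge0// q0_ge0.
have ma : measurable_fun D a by apply: measurable_funD; apply: measurable_funM.
have Ia : (\int[mu]_(u in D) (a u)%:E <= (4 * s ^+ 2 + 1)%:E)%E.
  under eq_integral do rewrite EFinD !EFinM.
  rewrite ge0_integralD//; last 4 first.
  - by move=> u _; rewrite -EFinM lee_fin mulr_ge0.
  - by apply: measurable_funeM; exact/measurable_EFinP.
  - by move=> u uI; rewrite -EFinM lee_fin mulr_ge0// q0_ge0.
  - by apply: measurable_funeM; exact/measurable_EFinP.
  rewrite !ge0_integralZl_EFin//; last 3 first.
  - exact/measurable_EFinP.
  - by move=> u uI; rewrite lee_fin.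
  - exact/measurable_EFinP.
  rewrite integral_qp// Q_1 -EFinM.
  rewrite (_ : 4 * _ + 1 = 2 * s ^+ 2 * 1 + (2 * s ^+ 2 + 1) * 1); last by ring.
  by rewrite [leRHS]EFinD leeD2l// [leRHS]EFinM lee_pmul2l// lte_fin ltr_wpDl.
have : (\int[mu]_(u in D) (2 * s * dist u + qp u)%:E <=
        \int[mu]_(u in D) (a u + klq u)%:E)%E.
  apply: ae_le_integral => //.
  - by apply/measurable_EFinP; apply: measurable_funD => //; exact: measurable_funM.
  - by apply/measurable_EFinP; exact: measurable_funD.
  - apply: filterS f0Q0_gt0 => u /[apply] f0u.
    have q0u : 0 < q0 u by rewrite invr_gt0.
    have := normr_sub_le_mulr_ln_div (qp_ge0 u) q0u s0.
    by rewrite lee_fin -/(klq u) /a /dist; lra.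
have := addl_le mklq a0 (integrable_of_le ma a0 Ia).
move=> /[swap] /le_trans/[apply].
under eq_integral do rewrite EFinD EFinM.
rewrite ge0_integralD//; last 4 first.
- by move=> u _; rewrite -EFinM lee_fin mulr_ge0// /dist normr_ge0.
- by apply: measurable_funeM; exact/measurable_EFinP.
- by move=> u uI; rewrite lee_fin.
- exact/measurable_EFinP.
rewrite ge0_integralZl_EFin//; last 2 first.
- by move=> u _; rewrite lee_fin /dist normr_ge0.
- exact/measurable_EFinP.
rewrite integral_qp// Q_1 => h.
have {h} : ((2 * s)%:E * \int[mu]_(u in D) (dist u)%:E + 1 <=
    (4 * s ^+ 2 + 1 + 2 * s ^+ 2)%:E)%E.
  by apply: (le_trans h); rewrite [in leRHS]EFinD; apply: leeD => //; exact: ltW.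
have : (0 <= \int[mu]_(u in D) (dist u)%:E)%E.
  by apply: integral_ge0 => u _; rewrite lee_fin normr_ge0.
case: (\int[mu]_(u in D) (dist u)%:E)%E => [i| |] //.
  by rewrite -EFinM -EFinD !lee_fin => i0 h; nra.
by rewrite gt0_muley ?lte_fin ?mulr_gt0// addye.
Qed.

Lemma integral_max_ln_le (s : R) : 0 < s ->
  (KL01 q (quantile_density f0) < (2 * s ^+ 2)%:E)%E ->
  (\int[mu]_(u in D) (qp u * Num.max (ln (qp u / q0 u)) 0)%:E <=
   (3 * s + 2 * s ^+ 2)%:E)%E.
Proof.
move=> s0 kls; have Id := integral_dist_le s0 kls; move: kls; rewrite KL01_klq => kls.
apply: (@le_trans _ _ (\int[mu]_(u in D) (dist u + klq u)%:E)%E).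
  apply: ae_le_integral => //.
  - apply/measurable_EFinP; apply: measurable_funM => //; apply: measurable_maxr => //.
    apply: measurableT_comp => //.
    by apply: measurable_funM => //; exact: (measurableT_comp measurable_invr mq0).
  - by apply/measurable_EFinP; exact: measurable_funD.
  - apply: filterS f0Q0_gt0 => u /[apply] f0u; rewrite lee_fin.
    by apply: mulr_max_ln_div_le => //; rewrite invr_gt0.
have dist0 u : u \in `[0, 1] -> 0 <= dist u by rewrite normr_ge0.
apply: le_trans (addl_le mklq dist0 (integrable_of_le mdist dist0 Id)) _.
by rewrite EFinD; apply: leeD => //; exact: ltW.
Qed.

Lemma KL01_density_le (f : R -> R) (c : R) : is_derivative_version F f ->
  (\int[mu]_(u in D) (qp u * Num.max (ln (qp u / q0 u)) 0)%:E <= c%:E)%E ->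
  (KL01 f0 (EFin \o f) <= (K * c)%:E + \int[mu]_(u in D)
    lne (quantile_density f0 (F (Q0 u)) / quantile_density f0 u))%E.
Proof.
move=> Ff Ic.
have mf : measurable_fun D f by case: Ff.
have K0 : 0 <= K by exact: le_trans (f0_ge0 D1) (f0K D1).
have mq0F : measurable_fun D (q0 \o F) by exact: measurable_fun_transport trF _ _ _ mq0.
pose m u := Num.max (ln (qp u / q0 u)) 0.
have m0 u : 0 <= m u by rewrite le_max lexx orbT.
have mm : measurable_fun D m.
  apply: measurable_maxr => //; apply: measurableT_comp => //.
  by apply: measurable_funM => //; exact: (measurableT_comp measurable_invr mq0).
have mmF : measurable_fun D (m \o F).
  exact: measurable_fun_transport trF _ _ _ mm.
(* The bound for the first term of the decomposition: [f0 <= K], and transport by [F] turns the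
   integral of [m \o F] into that of [m * qp]. *)
pose a x := f0 x * m (F x).
have ma : measurable_fun D a by exact: measurable_funM.
have a0 x : x \in `[0, 1] -> 0 <= a x by move=> xI; rewrite mulr_ge0// f0_ge0.
have Ia : (\int[mu]_(x in D) (a x)%:E <= (K * c)%:E)%E.
  apply: (@le_trans _ _ (\int[mu]_(x in D) (K%:E * (m (F x))%:E))%E).
    apply: ge0_le_integral => //.
    - exact/measurable_EFinP.
    - by apply: measurable_funeM; exact/measurable_EFinP.
    - by move=> x xI; rewrite -EFinM lee_fin ler_wpM2r// f0K.
  rewrite ge0_integralZl_EFin//; last 2 first.
  - by move=> x _; rewrite lee_fin.
  - exact/measurable_EFinP.
  rewrite (ge0_integral_transport trF (g := EFin \o m))//; last 2 first.
  - exact/measurable_EFinP.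
  - by move=> x _; rewrite lee_fin.
  rewrite EFinM lee_wpmul2l ?lee_fin//; apply: le_trans Ic.
  by under eq_integral do rewrite /= -EFinM mulrC.
(* At [x = Q0 u] the argument is [q0 (tau u) / q0 u] with [tau = F \o Q0], so transport by [Q0]
   turns the integral in (B) into that of [g * f0]. *)
pose g x := ln (q0 (F x) * f0 x).
have mg : measurable_fun D g by apply: measurableT_comp => //; exact: measurable_funM.
have -> : (\int[mu]_(u in D) lne (quantile_density f0 (F (Q0 u)) / quantile_density f0 u) =
    \int[mu]_(x in D) (g x * f0 x)%:E)%E.
  rewrite -(integral_transport trQ0 mg); apply: ae_eq_integral => //.
  - apply: measurableT_comp; first exact: measurable_lne.
    rewrite (_ : (fun u => _) =
        (fun u => (f0 (Q0 (F (Q0 u))))%:E^-1 * (f0 (Q0 u))%:E)%E); last first.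
      by apply/funext => u; rewrite /quantile_density inveK.
    apply: emeasurable_funM; last exact/measurable_EFinP.
    apply: measurable_EFin_inve => //.
    apply: (measurable_fun_transport trQ0 (g := fun x => f0 (Q0 (F x)))).
    exact: (measurable_fun_transport trF (g := f0 \o Q0)).
  - by apply/measurable_EFinP; apply: (measurable_fun_transport trQ0 (g := g)).
  - have h := ae_transport trQ0 (ae_transport trF f0Q0_gt0).
    apply: filterS2 h f0Q0_gt0 => u + + uI => /(_ uI) fF /(_ uI) fu.
    rewrite /quantile_density -/F0 -/Q0 inveK inver gt_eqF//.
    by rewrite -EFinM lne_EFin// mulr_gt0// invr_gt0.
(* Almost everywhere [f = 1 / qp (F)], so [ln (f0 / f)] is [ln (qp (F) / q0 (F)) + g], and the first
   logarithm is at most [m (F)]. Where [f0] vanishes, both integrands are 0. *)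
apply: (@le_trans _ _ (\int[mu]_(x in D) (a x + g x * f0 x)%:E)%E).
  apply: ae_le_integral => //.
  - apply: emeasurable_funM; first exact/measurable_EFinP.
    apply: measurableT_comp; first exact: measurable_lne.
    apply: emeasurable_funM; first exact/measurable_EFinP.
    exact: measurable_EFin_inve.
  - by apply/measurable_EFinP; apply: measurable_funD => //; exact: measurable_funM.
  - have h1 := ae_derivative_version Q_0 Q_1 ndQ ucQ Qder iq Qint Ff.
    apply: filterS2 h1 (ae_transport trF f0Q0_gt0) => x + + xI.
    move=> /(_ xI)[qx fx] /(_ xI) f0x /=.
    have := f0_ge0 xI; rewrite le_eqVlt => /predU1P[f0x0|f0x0].
      by rewrite /a -f0x0 mul0e mul0r mulr0 addr0.
    rewrite fx inver gt_eqF ?invr_gt0// invrK -EFinM lne_EFin ?mulr_gt0//.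
    rewrite -EFinM lee_fin /a /g [ln _ * f0 x]mulrC -mulrDr ler_pM2l//.
    have q0x : 0 < q0 (F x) by rewrite invr_gt0.
    apply: (@le_trans _ _ (ln (qp (F x) / q0 (F x)) + ln (q0 (F x) * f0 x))); last first.
      by rewrite lerD2r le_max lexx.
    rewrite -lnM ?posrE ?mulr_gt0 ?invr_gt0// mulrA divfK ?gt_eqF// mulrC.
    exact: lexx.
apply: le_trans (addl_le _ a0 (integrable_of_le ma a0 Ia)) _ => //.
  exact: measurable_funM.
exact: leeD2r.
Qed.

Lemma KL01_density_lt (f : R -> R) (s t dlt : R) : is_derivative_version F f ->
  0 < s -> (KL01 q (quantile_density f0) < (2 * s ^+ 2)%:E)%E ->
  K * (2 * (3 * s)) < t ->
  (forall tau : R -> R, measurable_fun `[(0 : R), 1] tau ->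
    (forall u, u \in `[0, 1] -> tau u \in `[0, 1]) ->
    sup [set `|tau u - u| | u in `[0, 1]] < t ->
    (\int[mu]_(u in D)
      lne (quantile_density f0 (tau u) / quantile_density f0 u) < dlt%:E)%E) ->
  (KL01 f0 (EFin \o f) < (K * (3 * s + 2 * s ^+ 2) + dlt)%:E)%E.
Proof.
move=> Ff s0 kls st h.
apply: le_lt_trans (KL01_density_le Ff (integral_max_ln_le s0 kls)) _.
rewrite EFinD lteD2lE//; apply: (h (F \o Q0)).
- apply: measurableT_comp; last by case: trQ0.
  exact: measurable_df_of_quantile.
- by move=> u _; exact: FD.
- apply: le_lt_trans st; apply: ge_sup.
    by exists `|(F \o Q0) 0 - 0|; exists 0 => //=; rewrite in_itv/= lexx ler01.
  by move=> _ [u uI <-]; apply: transport_map_close => //; exact: integral_dist_le.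
Qed.

End kullback_leibler.

(** * From almost sure properties to a set of positive probability *)

Lemma abs_continuous_on_unif_continuous (R : realType) (Q : R -> R) :
  abs_continuous_on `[0, 1] Q -> forall e : R, 0 < e -> exists2 t : R, 0 < t &
  forall x y : R, 0 <= x -> x <= y -> y <= 1 -> y - x < t -> Q y - Q x < e.
Proof.
move=> acQ e /acQ[t t0 tQ]; exists t => // x y x0 xy y1 yx.
have := tQ 1%N (fun=> x) (fun=> y); rewrite !big_ord1 => h.
apply: le_lt_trans (ler_norm _) (h _ _ yx).
- by move=> _; split; rewrite //= in_itv/= ?x0 ?y1 ?andbT ?(le_trans xy)// (le_trans x0).
- by move=> i j; rewrite (ord1 i) (ord1 j) eqxx.
Qed.

Lemma pos_prob_setD_ae d (T : measurableType d) (R : realType)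
    (P : probability T R) (B : set T) (G : T -> Prop) :
  measurable B -> (0 < P B)%E -> {ae P, forall w, G w} ->
  exists C : set T, [/\ measurable C, C `<=` B, forall w, C w -> G w & (0 < P C)%E].
Proof.
move=> mB PB [N [mN N0 GN]]; exists (B `\` N); split.
- exact: measurableD.
- exact: subDsetl.
- by move=> w [_ Nw]; apply: contrapT => nG; apply: Nw; exact: GN.
- have BN0 : P (B `&` N) = 0%E.
    by apply: subset_measure0 N0; [exact: measurableI|exact: mN|exact: subIsetr].
  by move: PB; rewrite (measureDI P mB mN) [X in (_ + X)%E]BN0 adde0.
Qed.

Unset Implicit Arguments.

Theorem proposition3p1 (R : realType) (d : measure_display)
  (T : measurableType d) (P : probability T R)
  (V : nat -> nat -> {RV P >-> R})
  (Q q f : T -> R -> R) (f0 : R -> R)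
  (V01 : forall m j w, is_node m j -> V m j w \in `[0, 1])
  (Vindep : levels_cond_indep V)
  (Qlim : {ae P, forall w, pyramid_limit (fun m j => V m j w) (Q w) (q w)})
  (QF_ac : {ae P, forall w, abs_continuous_on `[0, 1] (Q w) /\
                            abs_continuous_on setT (df_of_quantile (Q w))})
  (f_der : {ae P, forall w,
              is_derivative_version (df_of_quantile (Q w)) (f w)})
  (f0_density : is_density01 f0)
  (F0_ac : abs_continuous_on setT (df_of_density f0))
  (Q0_ac : abs_continuous_on `[0, 1] (quantile01 (df_of_density f0)))
  (hA : forall e : R, 0 < e ->
     has_pos_prob P [set w | (KL01 (q w) (quantile_density f0) < e%:E)%E])
  (hB : forall dlt : R, 0 < dlt -> exists2 e : R, 0 < e &
     forall tau : R -> R, measurable_fun `[(0 : R), 1] tau ->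
       (forall u, u \in `[0, 1] -> tau u \in `[0, 1]) ->
       sup [set `|tau u - u| | u in `[0, 1]] < e ->
       (\int[lebesgue_measure]_(u in `[0%R, 1%R])
          lne (quantile_density f0 (tau u) / quantile_density f0 u)
        < dlt%:E)%E)
  (hC : exists K : R, forall x, x \in `[0, 1] -> f0 x <= K) :
  forall e : R, 0 < e ->
    has_pos_prob P [set w | (KL01 f0 (EFin \o f w) < e%:E)%E].
Proof.
move=> e e0.
have [K0 f0K0] := hC.
(* The maximum with 1 makes the bound positive, so that it can be divided by. *)
pose K := Num.max K0 1.
have f0K x : x \in `[0, 1] -> f0 x <= K.
  by move=> /f0K0 h; rewrite le_max h.
have K_gt0 : 0 < K by rewrite lt_max ltr01 orbT.
have [t t0 ht] := hB (e / 2) (divr_gt0 e0 (ltr0n R 2)).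
(* As [s <= 1], [K (3 s + 2 s^2) <= 5 K s <= e / 4]; with [e / 2] from (B) the total is below [e].
   The last bound gives [6 K s <= t / 2 < t], which makes the transport map admissible in (B). *)
pose s := Num.min 1 (Num.min (e / (20 * K)) (t / (12 * K))).
have s0 : 0 < s by rewrite !lt_min ltr01 !divr_gt0// mulr_gt0.
have s1 : s <= 1 by rewrite ge_min lexx.
have se : K * (3 * s + 2 * s ^+ 2) <= e / 4.
  have : s <= e / (20 * K) by rewrite !ge_min lexx !orbT.
  rewrite ler_pdivlMr ?mulr_gt0// => h.
  have : K * s ^+ 2 <= K * s.
    by rewrite expr2 mulrA; apply: ler_piMr => //; apply: mulr_ge0; exact: ltW.
  nra.
have st : K * (2 * (3 * s)) <= t / 2.
  have : s <= t / (12 * K) by rewrite !ge_min lexx !orbT.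
  rewrite ler_pdivlMr ?mulr_gt0// => h; nra.
have [B [mB Bkl PB]] := hA (2 * s ^+ 2) (mulr_gt0 (ltr0n R 2) (exprn_gt0 2 s0)).
(* Removing from [B] a null set outside which all almost sure hypotheses hold leaves a measurable
   set of positive probability on which the bound is deterministic. *)
have [C [mC CB CG PC]] :
  exists C : set T, [/\ measurable C, C `<=` B, forall w, C w ->
    [/\ pyramid_limit (fun m j => V m j w) (Q w) (q w),
      abs_continuous_on `[0, 1] (Q w) /\ abs_continuous_on setT (df_of_quantile (Q w)) &
      is_derivative_version (df_of_quantile (Q w)) (f w)] & (0 < P C)%E].
  apply: pos_prob_setD_ae mB PB _.
  by apply: filterS3 Qlim QF_ac f_der.
exists C; split => // w Cw.
have [[Qc _ Qder iq Qint] [acQ _] fder] := CG w Cw.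
have v01 m j : is_node m j -> V m j w \in `[0, 1] by exact: V01.
have Q_0 := pyramid_limit0 Qc.
have Q_1 := pyramid_limit1 Qc.
have ndQ := nondecreasing_pyramid_limit v01 Qc.
have ucQ := abs_continuous_on_unif_continuous acQ.
have kl := Bkl w (CB w Cw).
have := KL01_density_lt f0_density f0K Q_0 Q_1 ndQ ucQ Qder iq Qint fder s0 kl _ ht.
move=> /(_ _)/lt_le_trans; apply; first by lra.
by rewrite lee_fin; lra.
Qed.
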